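(* There are at least $25$ pairwise non-isomorphic planar $4$-face deflatable hypohamiltonian graphs on $40$ vertices.
   Context: All graphs are finite. A graph $G$ is hypohamiltonian if it is simple, has no Hamiltonian cycle, and $G-v$ has a Hamiltonian cycle for every vertex $v$ of $G$. A $k$-face of a plane graph is a face of size $k$. The dual of a plane graph $G$ is denoted $G^*$. 2-path inflater $\mathcal{PI}_2$: let $H$ be a plane graph (loops and multiple edges allowed) with a path $v_1v_5v_3$ of length 2 (three distinct vertices), such that $v_1$ and $v_3$ have degree at least 3 and, in the cyclic order of edges around $v_5$, each of the two intervals between the edge $v_5v_1$ and the edge $v_5v_3$ contains at least one further edge-end at $v_5$. The operation replaces $v_5$ by two new vertices $v_2,v_4$, each joined to both $v_1$ and $v_3$, so that $v_1v_2v_3v_4$ bounds a new 4-face (occupying the place of the path); the edge-ends at $v_5$ on one side of the path are attached to $v_4$ and those on the other side to $v_2$, keeping their cyclic order; the rest of the plane graph is unchanged. $\mathcal{PI}_2(H)$ denotes the set of all plane graphs obtained from $H$ by one such operation. Let $\mathcal{D}_5(n)$ be the set of all simple connected plane graphs with $n$ faces and minimum degree at least 5. Define recursively $\mathcal{M}^4_0(n)=\{G^*: G\in\mathcal{D}_5(n)\}$ and, for $f>0$, $\mathcal{M}^4_f(n)=\bigcup_{G\in\mathcal{M}^4_{f-1}(n-1)}\mathcal{PI}_2(G)$. The graphs in $\mathcal{M}^4_f(n)$ have $n$ vertices; graphs belonging to some $\mathcal{M}^4_f(n)$ are called $4$-face deflatable. A planar $4$-face deflatable hypohamiltonian graph on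 $n$ vertices is a hypohamiltonian graph belonging to $\bigcup_{f=0}^{n-20}\mathcal{M}^4_f(n)$. *)

(* Defs.v *)
From mathcomp Require Import all_boot.

Set Implicit Arguments.
Unset Strict Implicit.
Unset Printing Implicit Defensive.

(* Connected plane multigraphs (with at least one edge) as combinatorial maps.
   A dart is an edge-end, i.e. an edge directed away from that end; [edge]
   reverses a dart, [node] is the counterclockwise rotation of the darts leaving
   a vertex, and [face] sends a dart to the next one along the boundary of the
   face on its left.  Vertices, edges and faces are the orbits of [node], [edge]
   and [face], and Euler's formula says that the surface is the sphere.
   Euler's formula also excludes the empty map, and every plane graph occurring
   below is connected and has an edge. *)
Record plane_graph := PlaneGraph {
  dart : finType;
  edge : dart -> dart;
  node : dart -> dart;
  face : dart -> dart;
  edgeK : involutive edge;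
  edge_neq : forall x, edge x != x;
  nodeface : forall x, node (face x) = edge x;
  map_connected : forall x y, connect (relU (frel edge) (frel node)) x y;
  euler : fcard node dart + fcard face dart = fcard edge dart + 2
}.

Arguments edge {p}.
Arguments node {p}.
Arguments face {p}.

Lemma edge_inj (G : plane_graph) : injective (@edge G).
Proof. exact: inv_inj (@edgeK G). Qed.

Lemma face_inj (G : plane_graph) : injective (@face G).
Proof. by move=> x y /(congr1 node); rewrite !nodeface => /edge_inj. Qed.

Lemma faceedgenode (G : plane_graph) (x : dart G) : face (edge (node x)) = x.
Proof.
have [g fg gf] := injF_bij (@face_inj G).
rewrite -{1}(gf x) nodeface edgeK; exact: gf.
Qed.

Lemma node_inj (G : plane_graph) : injective (@node G).
Proof. exact: (can_inj (g := face \o edge) (@faceedgenode G)). Qed.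

Section Dual.

Variable G : plane_graph.

(* The dual of the dart [x] crosses [x] from the face on its left to the face on
   its right.  So the rotation of the dual is [face], and this forces its face
   function. *)
Definition dual_face (x : dart G) : dart G := edge (node (edge x)).

Lemma dual_nodeface (x : dart G) : face (dual_face x) = edge x.
Proof. exact: faceedgenode. Qed.

Lemma dual_face_inj : injective dual_face.
Proof. by move=> x y /edge_inj /node_inj /edge_inj. Qed.

Lemma dual_connected (x y : dart G) :
  connect (relU (frel (@edge G)) (frel (@face G))) x y.
Proof.
set r := relU _ _.
have edge_r u : connect r u (edge u) by apply: connect1; rewrite /r /= eqxx.
have face_r : subrel (frel (@face G)) (connect r).
  by move=> u v uv; apply: connect1; rewrite /r /=; apply/orP; right.
apply: connect_sub (map_connected x y) => u v /orP[] /eqP <- //.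
have fc : fconnect face u (edge (node u)).
  by rewrite (fconnect_sym (@face_inj G)) -{2}(faceedgenode u) fconnect1.
apply: connect_trans (connect_sub face_r fc) _.
by rewrite -{2}(edgeK (node u)).
Qed.

Lemma fcard_dual_face : fcard dual_face (dart G) = fcard (@node G) (dart G).
Proof.
symmetry.
have symN := fconnect_sym (@node_inj G).
have symD := fconnect_sym dual_face_inj.
rewrite (adjunction_n_comp (@edge G) symD symN (a := predT)) //.
apply: strict_adjunction => //.
- exact: edge_inj.
- by apply/subsetP => x _; rewrite -[x]edgeK codom_f.
move=> x y _ /=.
by rewrite /dual_face edgeK (inj_eq (@edge_inj G)).
Qed.

Lemma dual_euler :
  fcard (@face G) (dart G) + fcard dual_face (dart G)
  = fcard (@edge G) (dart G) + 2.
Proof. by rewrite fcard_dual_face addnC euler. Qed.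

Definition dual : plane_graph :=
  PlaneGraph (@edgeK G) (@edge_neq G) dual_nodeface dual_connected dual_euler.

End Dual.

Definition same_vertex (G : plane_graph) : rel (dart G) := fconnect node.

Definition degree (G : plane_graph) (x : dart G) : nat := order node x.

Definition nb_faces (G : plane_graph) : nat := fcard (@face G) (dart G).

Definition simple (G : plane_graph) : Prop :=
  (forall x : dart G, ~~ same_vertex x (edge x)) /\
  (forall x y : dart G,
     same_vertex x y -> same_vertex (edge x) (edge y) -> x = y).

(* A vertex is represented by the canonical root of its [node] orbit. *)
Definition vertex (G : plane_graph) : finType :=
  {x : dart G | x \in froots (@node G)}.

Definition adj (G : plane_graph) : rel (vertex G) := fun u v =>
  [exists x : dart G,
     same_vertex (val u) x && same_vertex (val v) (edge x)].

(* The subgraph of the graph [e] induced by [A] has a Hamiltonian cycle. *)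
Definition hamiltonian (T : finType) (e : rel T) (A : {set T}) : Prop :=
  exists s : seq T, [/\ ucycle e s, 3 <= size s & s =i A].

Definition hypohamiltonian (G : plane_graph) : Prop :=
  [/\ simple G,
      ~ hamiltonian (@adj G) [set: vertex G]
    & forall v : vertex G, hamiltonian (@adj G) [set~ v]].

(* Isomorphism of the underlying abstract graphs, which does not have to respect
   the embeddings. *)
Definition isomorphic (G H : plane_graph) : Prop :=
  exists2 h : vertex G -> vertex H,
    bijective h & forall u v, adj (h u) (h v) = adj u v.

(* [K] arises from [H] by inflating the path v1 v5 v3.  The dart [x1] of [H]
   goes from v5 to v1 and [x3] from v5 to v3; [L] and [R] list the remaining
   darts at v5 on either side of the path.  The map [i] embeds the darts of [H]
   in those of [K], so that [i x1] and [i x3] leave v4, while the new darts [y1]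
   and [y3] leave v2 towards v1 and v3.  The last five fields give the
   counterclockwise order in [K] at v4, v2, v1, v3, and elsewhere. *)
Record inflates (H K : plane_graph) (x1 x3 : dart H) (L R : seq (dart H))
    (i : dart H -> dart K) (y1 y3 : dart K) : Prop := Inflates {
  v5_rotation : orbit node x3 = x3 :: L ++ x1 :: R;
  L_nonempty : L != [::];
  R_nonempty : R != [::];
  v1_neq_v5 : ~~ same_vertex x1 (edge x1);
  v3_neq_v5 : ~~ same_vertex x3 (edge x3);
  v1_neq_v3 : ~~ same_vertex (edge x1) (edge x3);
  v1_degree : 3 <= degree (edge x1);
  v3_degree : 3 <= degree (edge x3);
  i_inj : injective i;
  i_edge : forall x, i (edge x) = edge (i x);
  new_darts_uniq : uniq [:: y1; edge y1; y3; edge y3];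
  new_darts : forall y,
    (y \in [:: y1; edge y1; y3; edge y3]) = (y \notin codom i);
  v4_rotation : fcycle node (map i (x3 :: rcons L x1));
  v2_rotation : fcycle node (y1 :: rcons (map i R) y3);
  v1_rotation : fcycle node (edge y1 :: map i (orbit node (edge x1)));
  v3_rotation : fcycle node (edge y3 :: map i (orbit node (node (edge x3))));
  other_rotations : forall x,
    ~~ same_vertex x1 x -> ~~ same_vertex (edge x1) x ->
    ~~ same_vertex (edge x3) x -> node (i x) = i (node x)
}.

Definition PI2 (H K : plane_graph) : Prop :=
  exists (x1 x3 : dart H) (L R : seq (dart H)) (i : dart H -> dart K)
         (y1 y3 : dart K), inflates x1 x3 L R i y1 y3.

(* Connectedness is part of [plane_graph]. *)
Definition D5 (n : nat) (G : plane_graph) : Prop :=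
  [/\ simple G, nb_faces G = n & forall x : dart G, 5 <= degree x].

Inductive M4 : nat -> nat -> plane_graph -> Prop :=
| M4_0 n G : D5 n G -> M4 0 n (dual G)
| M4_S f n G H : M4 f n G -> PI2 G H -> M4 f.+1 n.+1 H.

(* The inequality [f + 20 <= n] is f <= n - 20 without truncated subtraction. *)
Definition deflatable_hypohamiltonian (n : nat) (G : plane_graph) : Prop :=
  hypohamiltonian G /\ exists f : nat, f + 20 <= n /\ M4 f n G.

(* Main.v *)
(* All 25 graphs arise from the 35-vertex duals of 5-regular plane graphs on 22
   vertices by five inflations, so their faces are five 4-faces and 22
   pentagons; a computer search found the moves.  A plane graph is encoded by the
   permutation table of its rotation, with darts [2k] and [2k+1] reversing each
   other, and everything is decided on such tables.  A graph is shown to be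
   non-Hamiltonian by sweeping over its vertices while recording, for each set
   of chosen edges that consists of disjoint paths, which vertices are paired as
   the two ends of a path: no choice ever closes up into a Hamiltonian cycle.
   Non-isomorphism follows from the sums of the colours after a few rounds of
   colour refinement. *)
Require Import Defs.
From mathcomp Require Import all_boot.
From Stdlib Require Import BinNums PArith.BinPos.

Set Implicit Arguments.
Unset Strict Implicit.
Unset Printing Implicit Defensive.

(** * Permutation tables *)

(** The plane graphs themselves are never evaluated. Each is only known to exist and to have its
    darts or vertices matched with the positions of a table by a [numbering], and every test on
    tables is transferred along such numberings. The dual keeps the numbering of the darts and only
    swaps the rotation table for the face table. Tests are proved in one direction: success implies
    the property. A failed search or a badly decoded cycle could only make the final evaluation
    return [false]. Non-Hamiltonicity is the one place where a search must be exhaustive. Its proof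
    follows a single hypothetical Hamiltonian cycle: the list of states always contains the state of
    the part of this cycle already passed, and that state can disappear only when the sweep reports
    a closing edge. Pairing the ends of paths suffices because, along a Hamiltonian cycle, an edge
    between two paired ends can only be the very last one. That every vertex-deleted subgraph is
    Hamiltonian is shown by explicit cycles, stored as the branching decisions of a walk. *)

Fixpoint walk (s : seq nat) k x fuel :=
  if fuel is n.+1 then
    if x == k then [::] else x :: walk s k (nth 0 s x) n
  else [::].

Definition cyc s k := k :: walk s k (nth 0 s k) (size s).

Definition cyc_min s k := foldr minn k (cyc s k).

Definition reps s := [seq k <- iota 0 (size s) | cyc_min s k == k].

Record numbering (T : Type) (code : T -> nat) (m : nat) : Prop := Numbering {
  code_inj : injective code;
  code_lt : forall x, code x < m;
  code_onto : forall k, k < m -> exists x, code x = k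
}.

Lemma numbering_ord m : numbering (@nat_of_ord m) m.
Proof.
by split=> [|//|k km]; [exact: val_inj | exists (Ordinal km)].
Qed.

Lemma numbering_map (T : Type) (code : T -> nat) m s :
  numbering code m -> all (fun k => k < m) s -> exists t, map code t = s.
Proof.
move=> num; elim: s => [|k s IHs] /=; first by exists [::].
case/andP=> /(code_onto num)[x <-] /IHs[t <-]; by exists (x :: t).
Qed.

Lemma card_numbering (T : finType) (code : T -> nat) m :
  numbering code m -> #|T| = m.
Proof.
case=> inj lt onto; pose g x := Ordinal (lt x).
have g_inj : injective g by move=> x y /(congr1 val) /inj.
rewrite -[RHS](card_ord m) -(card_codom g_inj); apply: eq_card => k.
have [x ex] := onto k (ltn_ord k); apply/codomP; exists x; exact: val_inj.
Qed.

Lemma walk_traject s k x n fuel :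
  n <= fuel -> k \notin traject (nth 0 s) x n -> iter n (nth 0 s) x = k ->
  walk s k x fuel = traject (nth 0 s) x n.
Proof.
elim: n x fuel => [|n IHn] x [|fuel] //=; first by move=> _ _ ->; rewrite eqxx.
rewrite inE negb_or eq_sym ltnS => le_n /andP[/negPf -> nk].
by rewrite -iterS iterSr => /IHn ->.
Qed.

Lemma foldr_minn_mem k t : k \in t -> foldr minn k t \in t.
Proof.
suff H : foldr minn k t \in k :: t.
  by move=> kt; move: H; rewrite inE => /predU1P[->|].
elim: t => [|a t]; rewrite ?mem_head //= !inE => /orP[/eqP->|ih].
  by rewrite /minn; case: ifP; rewrite eqxx ?orbT.
by rewrite /minn; case: ifP; rewrite ?eqxx ?ih ?orbT.
Qed.

Lemma foldr_minn_le k t j : j \in t -> foldr minn k t <= j.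
Proof.
elim: t => //= a t IHt; rewrite inE geq_min => /predU1P[->|/IHt ->].
  by rewrite leqnn.
by rewrite orbT.
Qed.

Section Table.

Variables (T : finType) (code : T -> nat) (s : seq nat) (f : T -> T).
Hypothesis num : numbering code (size s).
Hypothesis codef : forall x, code (f x) = nth 0 s (code x).
Hypothesis f_inj : injective f.

Lemma code_iter n x : code (iter n f x) = iter n (nth 0 s) (code x).
Proof. by elim: n => //= n <-. Qed.

Lemma code_traject n x :
  map code (traject f x n) = traject (nth 0 s) (code x) n.
Proof. by elim: n x => //= n IHn x; rewrite IHn codef. Qed.

Lemma code_orbit x : map code (orbit f x) = cyc s (code x).
Proof.
have: order f x <= size s by rewrite -(card_numbering num) max_card.
have := orbit_uniq f x; have := iter_order f_inj x.
rewrite /orbit -orderSpred; move: _.-1 => n; rewrite iterSr /= => fx.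
case/andP=> xn _ /ltnW le_n; rewrite /cyc -codef.
rewrite (walk_traject (n := n)) ?code_traject //.
  by rewrite -code_traject mem_map //; apply: code_inj num.
by rewrite -code_iter fx.
Qed.

Lemma fconnect_cyc x y : fconnect f x y = (code y \in cyc s (code x)).
Proof.
by rewrite -code_orbit mem_map ?fconnect_orbit //; apply: code_inj num.
Qed.

Lemma order_cyc x : order f x = size (cyc s (code x)).
Proof. by rewrite -code_orbit size_map size_orbit. Qed.

Lemma cyc_min_mem k : cyc_min s k \in cyc s k.
Proof. by rewrite foldr_minn_mem ?mem_head. Qed.

Lemma cyc_min_le k j : j \in cyc s k -> cyc_min s k <= j.
Proof. exact: foldr_minn_le. Qed.

Lemma cyc_min_code x : exists2 y, fconnect f x y & code y = cyc_min s (code x).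
Proof.
have := cyc_min_mem (code x); rewrite -code_orbit => /mapP[y yo ->].
by exists y => //; rewrite fconnect_orbit.
Qed.

Lemma fconnect_cyc_min x y :
  fconnect f x y = (cyc_min s (code x) == cyc_min s (code y)).
Proof.
have sym := fconnect_sym f_inj.
apply/idP/eqP => [xy | exy].
  have [x' xx' ex'] := cyc_min_code x; have [y' yy' ey'] := cyc_min_code y.
  apply/eqP; rewrite eqn_leq; apply/andP; split.
    by rewrite -ey' cyc_min_le // -fconnect_cyc (connect_trans xy).
  by rewrite -ex' cyc_min_le // -fconnect_cyc (connect_trans _ xx') // sym.
have [x' xx' ex'] := cyc_min_code x; have [y' yy' ey'] := cyc_min_code y.
have: x' = y' by apply: (code_inj num); rewrite ex' ey'.
by move=> e; rewrite (connect_trans xx') // e sym.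
Qed.

Lemma cyc_min_reps x : cyc_min s (code x) \in reps s.
Proof.
have [y xy ey] := cyc_min_code x; rewrite mem_filter -ey mem_iota (code_lt num).
by rewrite andbT {2}ey -fconnect_cyc_min (fconnect_sym f_inj) xy.
Qed.

Lemma reps_code k :
  k \in reps s -> exists2 x, code x = k & cyc_min s (code x) = k.
Proof.
rewrite mem_filter mem_iota => /and3P[/eqP ek _ /(code_onto num)[x ex]].
by exists x => //; rewrite ex.
Qed.

Lemma uniq_reps : uniq (reps s).
Proof. by rewrite filter_uniq ?iota_uniq. Qed.

(** [fcard] counts the roots picked by [froot], which need not have the least code in their orbits.
    Mapping a root to the least code of its orbit is a bijection between the two systems of
    representatives. *)
Lemma fcard_reps : fcard f T = size (reps s).
Proof.
have sym := fconnect_sym f_inj.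
pose g x := cyc_min s (code x).
have -> : fcard f T = size (map g (enum (froots f))).
  by rewrite size_map -cardE; apply: eq_card => x; rewrite !inE andbT.
apply/perm_size/uniq_perm; rewrite ?uniq_reps //.
  rewrite map_inj_in_uniq ?enum_uniq // => x y.
  rewrite !mem_enum => /eqP rx /eqP ry /eqP.
  by rewrite -fconnect_cyc_min => /(rootP sym); rewrite rx ry.
move=> k; apply/mapP/idP => [[x _ ->] | /reps_code[x _ <-]].
  exact: cyc_min_reps.
exists (froot f x); first by rewrite mem_enum; apply: roots_root.
by apply/eqP; rewrite -fconnect_cyc_min connect_root.
Qed.

End Table.

(** * Plane graphs from tables *)

Definition flip k := if odd k then k.-1 else k.+1.

Lemma flipK : involutive flip.
Proof. by case=> // k; rewrite /flip /=; case ok: (odd k); rewrite /= ok. Qed.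

Lemma flip_neq k : flip k != k.
Proof.
by rewrite /flip; case: ifP; case: k => //= k _; rewrite neq_ltn leqnn ?orbT.
Qed.

Lemma flip_lt m k : ~~ odd m -> k < m -> flip k < m.
Proof.
rewrite /flip; case: ifP => ok om km.
  exact: leq_ltn_trans (leq_pred k) km.
by rewrite ltn_neqAle km andbT; apply: contraNneq om => <-; rewrite /= ok.
Qed.

(** [face] is left out because [nodeface] and the injectivity of [node] determine it. *)
Record represents (G : plane_graph) (nd : seq nat) (code : dart G -> nat) :
    Prop := Represents {
  rep_num : numbering code (size nd);
  rep_edge : forall x, code (edge x) = flip (code x);
  rep_node : forall x, code (node x) = nth 0 nd (code x)
}.

(* [node \o face = edge], so the face table is the inverse of the node table
   composed with [flip]. *)
Definition face_table nd :=
  let inv := foldl (fun t k => set_nth 0 t (nth 0 nd k) k) (map (fun=> 0) nd)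
                   (iota 0 (size nd)) in
  [seq nth 0 inv (flip k) | k <- iota 0 (size nd)].

Fixpoint reach (nd : seq nat) fuel (seen : seq bool) k :=
  if fuel is n.+1 then
    if nth false seen k then seen
    else
      reach nd n (reach nd n (set_nth false seen k true) (flip k)) (nth 0 nd k)
  else seen.

Definition is_map nd :=
  let m := size nd in
  let fc := face_table nd in
  let seen := reach nd m (nseq m false) 0 in
  [&& ~~ odd m, all (fun k => k < m) nd, all (fun k => k < m) fc,
      all (fun k => nth 0 nd (nth 0 fc k) == flip k) (iota 0 m)
    & all (nth false seen) (iota 0 m) &&
      (size (reps nd) + size (reps fc)
       == size (reps (map flip (iota 0 m))) + 2)].

(** Soundness of the depth-first search: it marks only what every set closed under [flip] and the
    rotation must contain. Running out of fuel would merely leave darts unmarked. *)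
Lemma reach_ind nd (P : pred nat) fuel seen k :
  (forall j, P j -> P (flip j)) -> (forall j, P j -> P (nth 0 nd j)) ->
  P k -> (forall j, nth false seen j -> P j) ->
  forall j, nth false (reach nd fuel seen k) j -> P j.
Proof.
move=> Pflip Pnode; elim: fuel seen k => [|n IHn] seen k Pk Ps //=.
case: ifP => // _; apply: (IHn _ _ (Pnode _ Pk)).
apply: (IHn _ _ (Pflip _ Pk)) => j; rewrite nth_set_nth /=.
by case: eqP => [-> _ //|_]; apply: Ps.
Qed.

Lemma map_of_table nd : is_map nd ->
  exists G (code : dart G -> nat), represents nd code.
Proof.
rewrite /is_map; set fc := face_table nd; set m := size nd.
case/and5P=> om /allP nd_lt /allP fc_lt /allP nd_fc /andP[/allP conn /eqP eul].
have sz_fc : size fc = m by rewrite size_map size_iota.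
pose e (x : 'I_m) : 'I_m := insubd x (flip x).
pose n (x : 'I_m) : 'I_m := insubd x (nth 0 nd x).
pose f (x : 'I_m) : 'I_m := insubd x (nth 0 fc x).
have eE x : val (e x) = flip x by rewrite val_insubd flip_lt.
have nE x : val (n x) = nth 0 nd x by rewrite val_insubd nd_lt ?mem_nth.
have fE x : val (f x) = nth 0 fc x by rewrite val_insubd fc_lt ?mem_nth ?sz_fc.
have eK : involutive e by move=> x; apply: val_inj; rewrite !eE flipK.
have e_neq x : e x != x by rewrite -val_eqE /= eE flip_neq.
have nf x : n (f x) = e x.
  by apply: val_inj; rewrite nE fE eE; apply/eqP/nd_fc; rewrite mem_iota /=.
have f_inj : injective f.
  by move=> x y /(congr1 n); rewrite !nf; apply: (inv_inj eK).
have n_inj : injective n.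
  have [g fg gf] := injF_bij f_inj.
  by move=> x y; rewrite -(gf x) -(gf y) !nf => /(inv_inj eK) ->.
have cn x y : connect (relU (frel e) (frel n)) x y.
  set r := relU _ _.
  have symr : connect_sym r.
    by apply: relU_sym; apply: fconnect_sym => //; apply: inv_inj eK.
  have m_gt0 : 0 < m by apply: leq_ltn_trans (ltn_ord x).
  pose x0 := Ordinal m_gt0.
  suff from0 z : connect r x0 z by rewrite (connect_trans _ (from0 y)) // symr.
  pose P k := [exists z : 'I_m, (val z == k) && connect r x0 z].
  suff /existsP[u /andP[/eqP /val_inj -> //]] : P z.
  have zm : val z \in iota 0 m by rewrite mem_iota /=.
  apply: reach_ind (conn _ zm) => [j|j||j].
  - case/existsP=> u /andP[/eqP <- cu]; apply/existsP; exists (e u).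
    rewrite eE eqxx (connect_trans cu) // connect1 //.
    by rewrite /r /= eqxx.
  - case/existsP=> u /andP[/eqP <- cu]; apply/existsP; exists (n u).
    rewrite nE eqxx (connect_trans cu) // connect1 //.
    by rewrite /r /= eqxx orbT.
  - by apply/existsP; exists x0; rewrite eqxx connect0.
  by rewrite nth_nseq if_same.
have eu : fcard n 'I_m + fcard f 'I_m = fcard e 'I_m + 2.
  have num (t : seq nat) : size t = m -> numbering (@nat_of_ord m) (size t).
    by move->; apply: numbering_ord.
  rewrite (fcard_reps (num nd _) nE n_inj) //.
  rewrite (fcard_reps (num fc sz_fc) fE f_inj).
  rewrite (fcard_reps (num (map flip (iota 0 m)) _) _ (inv_inj eK)) //.
    by rewrite size_map size_iota.
  by move=> x; rewrite eE (nth_map 0) ?size_iota ?nth_iota.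
exists (PlaneGraph eK e_neq nf cn eu), (@nat_of_ord m); split=> //.
exact: numbering_ord.
Qed.

Definition ends nd k := (cyc_min nd k, cyc_min nd (flip k)).

Definition simple_table nd :=
  let es := map (ends nd) (iota 0 (size nd)) in
  all (fun p => p.1 != p.2) es && uniq es.

Definition D5_table nd :=
  simple_table nd && all (fun k => 5 <= size (cyc nd k)) (iota 0 (size nd)).

Section Represented.

Variables (G : plane_graph) (nd : seq nat) (code : dart G -> nat).
Hypothesis rep : represents nd code.

Let num := rep_num rep.

Lemma same_vertex_cyc x y : same_vertex x y = (code y \in cyc nd (code x)).
Proof. exact: fconnect_cyc num (rep_node rep) (@node_inj G) x y. Qed.

Lemma degree_cyc x : degree x = size (cyc nd (code x)).
Proof. exact: order_cyc num (rep_node rep) (@node_inj G) x. Qed.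

Lemma same_vertex_cyc_min x y :
  same_vertex x y = (cyc_min nd (code x) == cyc_min nd (code y)).
Proof. exact: fconnect_cyc_min num (rep_node rep) (@node_inj G) x y. Qed.

(** [is_map] checks that the rotation table after the face table is [flip]. As [node] is injective,
    this identifies the face table with [face], the rotation of the dual. *)
Lemma represents_dual :
  is_map nd -> represents (G := dual G) (face_table nd) code.
Proof.
case/and5P=> _ _ /allP fc_lt /allP nd_fc _.
have sz_fc : size (face_table nd) = size nd by rewrite size_map size_iota.
split=> [|x|x]; [by rewrite sz_fc | exact: rep_edge rep x |].
have lt : nth 0 (face_table nd) (code x) < size nd.
  by rewrite fc_lt // mem_nth // sz_fc (code_lt num).
have [y ey] := code_onto num lt; rewrite -ey; congr code.
apply: (@node_inj G); rewrite [LHS](@nodeface G); apply: (code_inj num).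
rewrite (rep_edge rep) (rep_node rep) ey; apply/esym/eqP/nd_fc.
by rewrite mem_iota (code_lt num).
Qed.

Lemma simple_of_table : simple_table nd -> simple G.
Proof.
case/andP=> /allP loopless parallel_free; split=> [x|x y].
  rewrite same_vertex_cyc_min (rep_edge rep).
  apply: (loopless (ends nd (code x))).
  by rewrite map_f // mem_iota (code_lt num).
rewrite !same_vertex_cyc_min !(rep_edge rep) => /eqP exy /eqP efxy.
apply: (code_inj num); apply/eqP.
have lt z : code z < size (map (ends nd) (iota 0 (size nd))).
  by rewrite size_map size_iota (code_lt num).
rewrite -(nth_uniq (ends nd 0) (lt x) (lt y) parallel_free).
rewrite !(nth_map 0) ?size_iota ?(code_lt num) // !nth_iota ?(code_lt num) //.
by rewrite /ends exy efxy.
Qed.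

Lemma D5_of_table :
  is_map nd -> D5_table nd -> D5 (size (reps (face_table nd))) G.
Proof.
move=> nd_map /andP[simp /allP deg5]; split; first exact: simple_of_table.
  (* The faces of [G] are counted as the vertices of its dual. *)
  have repD := represents_dual nd_map.
  exact: fcard_reps (rep_num repD) (rep_node repD) (@face_inj G).
by move=> x; rewrite degree_cyc deg5 // mem_iota (code_lt num).
Qed.

End Represented.

(** * Inflation *)

(* With [m] darts in the old graph, the darts [y1], [edge y1], [y3], [edge y3] of
   [inflates] are numbered [m], [m.+1], [m.+2], [m.+3]. *)
Definition inflate nd x1 x3 :=
  let m := size nd in
  mkseq (fun k =>
    if k == x1 then x3
    else if nth 0 nd k == x3 then m.+2
    else if nth 0 nd k == flip x1 then m.+1
    else if k == flip x3 then m.+3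
    else nth 0 nd k) m
  ++ [:: nth 0 nd x1; flip x1; m; nth 0 nd (flip x3)].

Lemma size_inflate nd x1 x3 : size (inflate nd x1 x3) = (size nd).+4.
Proof. by rewrite size_cat size_mkseq addn4. Qed.

(** The new rotations are tested on the resulting table instead of being derived from the case
    distinction in [inflate]. In [o] the dart [x3] has index 0, so [L] has one entry fewer than the
    index of [x1]. The vertex v2 takes over [R], which lies to the left of the dart towards v1 and
    to the right of the dart towards v3; hence the new dart comes just before [flip x1] at v1, but
    just after [flip x3] at v3. *)
Definition inflatable nd x1 x3 :=
  let m := size nd in
  let nd' := inflate nd x1 x3 in
  let turn := nth 0 nd' in
  let o := cyc nd x3 in
  let L := take (index x1 o).-1 (behead o) in
  let R := drop (index x1 o).+1 o in
  let o1 := cyc nd (flip x1) in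
  let o3 := cyc nd (flip x3) in
  [&& [&& ~~ odd m, x1 < m & x3 < m],
      [&& o == x3 :: L ++ x1 :: R, L != [::] & R != [::]],
      [&& flip x1 \notin o, flip x3 \notin o & flip x3 \notin o1],
      [&& 3 <= size o1 & 3 <= size o3]
    & [&& fcycle turn (x3 :: rcons L x1),
          fcycle turn (m :: rcons R m.+2),
          fcycle turn (m.+1 :: o1),
          fcycle turn (m.+3 :: cyc nd (nth 0 nd (flip x3)))
        & all (fun k => [|| k \in o, k \in o1, k \in o3
                          | turn k == nth 0 nd k])
              (iota 0 m)]].

Lemma PI2_of_table (G K : plane_graph) nd (cG : dart G -> nat)
    (cK : dart K -> nat) x1 x3 :
  represents nd cG -> represents (inflate nd x1 x3) cK ->
  inflatable nd x1 x3 -> PI2 G K.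
Proof.
move=> repG repK; rewrite /inflatable.
set m := size nd; set nd' := inflate nd x1 x3 in repK *.
set L := take _ _; set R := drop _ _.
case/and5P=> /and3P[om x1m x3m] /and3P[/eqP eo L0 R0].
case/and3P=> loop1 loop3 v13 /andP[deg1 deg3].
case/and5P=> c4 c2 c1 c3 /allP other.
have [numG edgeG nodeG] := repG; have [numK edgeK' nodeK] := repK.
have sz : size nd' = m.+4 by rewrite size_inflate.
have cG_lt x : cG x < m := code_lt numG x.
have [X1 eX1] := code_onto numG x1m; have [X3 eX3] := code_onto numG x3m.
have orbG x : map cG (orbit node x) = cyc nd (cG x).
  exact: code_orbit numG nodeG (@node_inj G) x.
have [L' [R' [eL eR]]] : exists L' R', map cG L' = L /\ map cG R' = R.
  have: all (fun k => k < m) (x3 :: L ++ x1 :: R).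
    rewrite -eo -eX3 -orbG; apply/allP=> _ /mapP[x _ ->]; exact: cG_lt.
  rewrite /= all_cat /= => /and4P[_ aL _ aR].
  have [L' eL] := numbering_map numG aL; have [R' eR] := numbering_map numG aR.
  by exists L', R'.
(* An old dart keeps its number in the enlarged table, which defines the embedding. *)
have [i ei] : exists i : dart G -> dart K, forall x, cK (i x) = cG x.
  have ex x : exists y, cK y == cG x.
    have [|y <-] := code_onto numK (k := cG x); last by exists y.
    by rewrite sz (leq_trans (cG_lt x)) // -addn4 leq_addr.
  exists (fun x => xchoose (ex x)) => x; exact/eqP/(xchooseP (ex x)).
have new j : j < 4 -> exists y, cK y = m + j.
  by move=> j4; apply: (code_onto numK); rewrite sz -addn4 ltn_add2l.
(* Since [m] is even, [flip] pairs [m] with [m.+1] and [m.+2] with [m.+3]. *)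
have [Y1 eY1] := new 0 isT; have [Y3 eY3] := new 2 isT.
rewrite addn0 in eY1; rewrite addn2 in eY3.
have eY1' : cK (edge Y1) = m.+1 by rewrite edgeK' eY1 /flip (negPf om).
have eY3' : cK (edge Y3) = m.+3.
  by rewrite edgeK' eY3 /flip /= negbK (negPf om).
have eYs : map cK [:: Y1; edge Y1; Y3; edge Y3] = iota m 4.
  by rewrite /= eY1 eY1' eY3 eY3'.
have same_v5 y : same_vertex X1 y = (cG y \in cyc nd x3).
  rewrite -eX3 -(same_vertex_cyc repG); apply: same_connect.
    exact: fconnect_sym (@node_inj G).
  have : same_vertex X3 X1.
    by rewrite (same_vertex_cyc repG) eX3 eX1 eo inE mem_cat mem_head !orbT.
  by rewrite /same_vertex (fconnect_sym (@node_inj G)).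
have injK : injective cK := code_inj numK.
have mono : {mono cK : x y / frel node x y >-> frel (nth 0 nd') x y}.
  by move=> x y /=; rewrite -nodeK (inj_eq injK).
have map_i s : map cK (map i s) = map cG s.
  by rewrite -map_comp; apply: eq_map => x /=; rewrite ei.
exists X1, X3, L', R', i, Y1, Y3; split.
- apply: (inj_map (code_inj numG)).
  by rewrite orbG eX3 eo /= map_cat /= eX3 eX1 eL eR.
- by rewrite -size_eq0 -(size_map cG) eL size_eq0.
- by rewrite -size_eq0 -(size_map cG) eR size_eq0.
- by rewrite same_v5 edgeG eX1.
- by rewrite (same_vertex_cyc repG) edgeG eX3.
- by rewrite (same_vertex_cyc repG) !edgeG eX1 eX3.
- by rewrite (degree_cyc repG) edgeG eX1.
- by rewrite (degree_cyc repG) edgeG eX3.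
- by move=> x y /(congr1 cK); rewrite !ei => /(code_inj numG).
- by move=> x; apply: injK; rewrite ei edgeG edgeK' ei.
- by rewrite -(map_inj_uniq injK) eYs iota_uniq.
- move=> y; rewrite -(mem_map injK) eYs mem_iota addn4 -sz (code_lt numK) andbT.
  rewrite leqNgt; congr (~~ _).
  apply/idP/codomP => [/(code_onto numG)[x ex] | [x ->]]; last by rewrite ei.
  by exists x; apply: injK; rewrite ei.
- rewrite -(mono_cycle mono) map_i /= map_rcons eL eX3 eX1; exact: c4.
- rewrite -(mono_cycle mono) /= map_rcons map_i eR eY1 eY3; exact: c2.
- by rewrite -(mono_cycle mono) map_cons map_i orbG edgeG eX1 eY1'.
- by rewrite -(mono_cycle mono) map_cons map_i orbG nodeG edgeG eX3 eY3'.
move=> x; rewrite same_v5 !(same_vertex_cyc repG) !edgeG eX1 eX3.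
move=> /negPf n1 /negPf n2 /negPf n3; apply: injK.
rewrite nodeK !ei nodeG; apply/eqP.
have := other (cG x); rewrite mem_iota cG_lt n1 n2 n3 /=; exact.
Qed.

Fixpoint inflations nd moves :=
  if moves is (x1, x3) :: moves' then inflations (inflate nd x1 x3) moves'
  else nd.

(** Testing [is_map] after every move replaces a proof that inflation preserves connectedness and
    Euler's formula. *)
Fixpoint inflatables nd moves :=
  if moves is (x1, x3) :: moves' then
    let nd' := inflate nd x1 x3 in
    [&& inflatable nd x1 x3, is_map nd' & inflatables nd' moves']
  else true.

Lemma M4_of_moves f n (G : plane_graph) nd (code : dart G -> nat) moves :
  represents nd code -> M4 f n G -> inflatables nd moves ->
  exists K (cK : dart K -> nat),
    represents (inflations nd moves) cK /\
    M4 (f + size moves) (n + size moves) K.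
Proof.
elim: moves f n G nd code => [|[x1 x3] moves IHm] f n G nd code repG MG /=.
  by exists G, code; rewrite /= !addn0.
case/and3P=> infl /map_of_table[K [cK repK]]; rewrite !addnS -!addSn.
by apply: IHm repK (M4_S MG (PI2_of_table repG repK infl)).
Qed.

(** * Hamiltonian cycles *)

Section HamiltonianCycle.

Variables (T : finType) (s : seq T).
Hypotheses (s_uniq : uniq s) (s_size : 2 < size s) (s_all : s =i [set: T]).

Definition cyc_adj : rel T := fun u v => (next s u == v) || (next s v == u).

Let in_s x : x \in s. Proof. by rewrite s_all inE. Qed.

Lemma cyc_adj_sym : symmetric cyc_adj.
Proof. by move=> u v; rewrite /cyc_adj orbC. Qed.

Lemma cyc_adjE u v : cyc_adj u v = (v \in [set next s u; prev s u]).
Proof.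
rewrite /cyc_adj !inE eq_sym; congr (_ || _).
by rewrite -[RHS](inj_eq (can_inj (prev_next s_uniq))) next_prev.
Qed.

Lemma next_rooted (v : T) p x :
  uniq (v :: p) -> x \in v :: p -> x != last v p ->
  index (next (v :: p) x) (v :: p) = (index x (v :: p)).+1.
Proof.
move=> u_p xp x_last; rewrite next_nth xp.
have lt : index x (v :: p) < size p.
  rewrite ltn_neqAle -ltnS -[(size p).+1]/(size (v :: p)) index_mem xp andbT.
  apply: contraNneq x_last => ex; rewrite -(nth_index v xp) ex.
  by rewrite -[size p]/(size (v :: p)).-1 nth_last.
by rewrite -[nth v p _]/(nth v (v :: p) _.+1) index_uniq.
Qed.

(** Cuts the cycle open between [x] and its successor. If [x] were not last, its successor would
    have a positive index, but it stands in front. *)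
Lemma rot_next x : exists i p, rot i s = next s x :: p /\ last (next s x) p = x.
Proof.
have [i p ep] := rot_to (in_s (next s x)); exists i, p; split=> //.
have u_p : uniq (next s x :: p) by rewrite -ep rot_uniq.
have xp : x \in next s x :: p by rewrite -ep mem_rot.
apply/esym/eqP; apply: contraT => x_last.
have := next_rooted u_p xp x_last.
by rewrite -{1}ep next_rot //= eqxx.
Qed.

Lemma next_neq x : next s x != x.
Proof.
have [i [p [ep lp]]] := rot_next x.
apply: contraTneq s_size => ex; rewrite -(size_rot i) ep.
have : next s x \notin p by move: s_uniq; rewrite -(rot_uniq i) ep => /andP[].
by case: p lp {ep} => //= y p lp; rewrite ex -{1}lp mem_last.
Qed.

Lemma next_neq_prev x : next s x != prev s x.
Proof.
have [i [p [ep lp]]] := rot_next x.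
have u_p : uniq (next s x :: p) by rewrite -ep rot_uniq.
apply: contraTneq s_size => enp; rewrite -(size_rot i) ep.
have nnx : next s (next s x) = x by rewrite enp next_prev.
have nx : next s x != last (next s x) p by rewrite lp next_neq.
have := next_rooted u_p (mem_head _ _) nx.
rewrite -{1}ep next_rot // nnx -{1}lp index_last // index_head => sp.
by rewrite /= sp.
Qed.

Lemma card_cyc_adj u : #|cyc_adj u| = 2.
Proof.
have -> : #|cyc_adj u| = #|[set next s u; prev s u]|.
  by apply: eq_card => v; rewrite -cyc_adjE.
by rewrite cards2 next_neq_prev.
Qed.

Lemma cyc_adj_irr u v : cyc_adj u v -> u != v.
Proof. by case/orP=> /eqP <-; rewrite ?next_neq // eq_sym next_neq. Qed.

(* Without the edge between [u] and [v] the cycle is a path with these ends, and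
   a subgraph of this path that connects the ends is the whole path. *)
Lemma closing_edge (X : rel T) u v : symmetric X -> subrel X cyc_adj ->
  cyc_adj u v -> ~~ X u v -> connect X u v ->
  forall x, x != u -> x != v -> #|X x| = 2.
Proof.
move=> symX subX; wlog nu : u v / next s u = v.
  move=> wl uv; case/orP: (uv) => /eqP e; first exact: wl.
  rewrite symX (sym_connect_sym symX) => nX cX x xu xv.
  by apply: (wl v u) => //; rewrite cyc_adj_sym.
move=> _ nX cX.
have [i [p []]] := rot_next u; rewrite nu => ep lp.
have u_p : uniq (v :: p) by rewrite -ep rot_uniq.
have in_p z : z \in v :: p by rewrite -ep mem_rot.
pose idx z := index z (v :: p).
have idx_next z : z != u -> idx (next s z) = (idx z).+1.
  by rewrite -lp -(next_rot i) // ep => zl; apply: next_rooted.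
(* If the edge from [z] to its successor were missing in [X], the initial segment of the path up to
   [z] would be closed under [X]. It contains [v], which has index 0, but not [u], which comes last,
   so [X] could not connect them. *)
have X_next z : z != u -> X z (next s z).
  move=> zu; apply: contraT => nXz.
  pose K : {pred T} := [pred y | idx y <= idx z].
  have closedK : closed X K.
    apply: intro_closed; first exact: sym_connect_sym.
    move=> x y xy; rewrite !inE => le_x.
    case/orP: (subX _ _ xy) => /eqP e.
      have x_u : x != u by apply: contraNneq nX => exu; rewrite -nu -exu e.
      rewrite -e idx_next // ltn_neqAle le_x andbT.
      apply: contraNneq nXz => exz.
      have exz' : x = z.
        by rewrite -(nth_index v (in_p x)) -/(idx x) exz nth_index.
      by rewrite -exz' e.
    have y_u : y != u by apply: contraNneq nX => eyu; rewrite symX -nu -eyu e.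
    by rewrite ltnW // -idx_next // e.
  have := closed_connect closedK (etrans (sym_connect_sym symX v u) cX).
  rewrite !inE [idx v]index_head leq0n => /esym le_u.
  have : idx z < size p.
    rewrite ltn_neqAle -ltnS -[(size p).+1]/(size (v :: p)) index_mem in_p.
    rewrite andbT; apply: contraNneq zu => ez.
    rewrite -(nth_index v (in_p z)) -/(idx z) ez.
    by rewrite -[size p]/(size (v :: p)).-1 nth_last /= lp.
  move: le_u.
  have -> : idx u = size p.
    by rewrite /idx -{1}lp index_last.
  by rewrite leqNgt => /negPf->.
move=> x xu xv; rewrite -(card_cyc_adj x); apply/eq_card => y.
apply/idP/idP => [/subX // | /orP[] /eqP e]; first by rewrite -e; apply: X_next.
rewrite [_ \in _]symX -e; apply: X_next.
by apply: contraNneq xv => eyu; rewrite -e eyu nu.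
Qed.

(* [X] consists of disjoint paths, and [m] sends an isolated vertex to itself, an
   end of a path to its other end, and an inner vertex to [None]. *)
Record matches (X : rel T) (m : T -> option T) : Prop := Matches {
  match_deg : forall x, #|X x| = if m x is Some y then (x != y : nat) else 2;
  match_connect : forall x y, m x = Some y -> connect X x y;
  match_inv : forall x y, m x = Some y -> m y = Some x;
  match_some : exists x, m x
}.

Definition add_edge (X : rel T) u v : rel T :=
  fun x y => [|| X x y, (x == u) && (y == v) | (x == v) && (y == u)].

(** Here [a] and [b] are the mates of [u] and [v]. They are tested first because [a] is [u] when [u]
    is isolated, and then [u] becomes an end of the new path rather than an inner vertex. *)
Definition join (m : T -> option T) u v a b x :=
  if x == a then Some b else if x == b then Some a
  else if (x == u) || (x == v) then None else m x.

Lemma eq_matches X Y m : X =2 Y -> matches X m -> matches Y m.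
Proof.
move=> eXY [deg conn inv some]; split=> // [x | x y mxy].
  by rewrite -deg; apply: eq_card => y; rewrite /in_mem /= eXY.
by rewrite -(eq_connect eXY); apply: conn.
Qed.

Section Step.

Variables (X : rel T) (m : T -> option T) (u v : T).
Hypotheses (symX : symmetric X) (subX : subrel X cyc_adj).
Hypothesis mX : matches X m.

(** The cycle has degree 2 everywhere, and [X] has degree 2 at [x] exactly when [x] has no mate.
    This is what allows the sweep to discard states in which a vertex it leaves behind still has
    one. *)
Lemma matches_full x : m x = None <-> X x =i cyc_adj x.
Proof.
have sub : X x \subset cyc_adj x by apply/subsetP => y; apply: subX.
have deg := match_deg mX x; split=> [mx | eX].
  by apply/(subset_cardP _ sub); rewrite deg mx card_cyc_adj.
move: deg; rewrite (eq_card eX) card_cyc_adj.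
by case: (m x) => // y; case: (_ != _).
Qed.

Hypotheses (uv : cyc_adj u v) (nX : ~~ X u v).

Lemma matches_open : (exists a, m u = Some a) /\ exists b, m v = Some b.
Proof.
split; [case E: (m u) => [a|] | case E: (m v) => [b|]].
- by exists a.
- by move/matches_full: E => /(_ v); rewrite [RHS]uv [LHS](negPf nX).
- by exists b.
move/matches_full: E => /(_ u).
by rewrite [RHS]cyc_adj_sym uv [LHS]symX (negPf nX).
Qed.

(** Mates are connected in [X], so by [closing_edge] the set [X] already gives every other vertex
    degree 2. Thus a cycle edge between mates never closes a short cycle, and the criterion in
    [closes] catches it. *)
Lemma matches_close : m u = Some v -> forall x, x != u -> x != v -> m x = None.
Proof.
move=> muv x xu xv; have := match_deg mX x.
rewrite (closing_edge symX subX uv nX (match_connect mX muv) xu xv).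
by case: (m x) => // y; case: (_ != _).
Qed.

Lemma matches_join a b : m u = Some a -> m v = Some b -> a != v ->
  matches (add_edge X u v) (join m u v a b).
Proof.
move=> mu mv av; have inv := match_inv mX; have deg := match_deg mX.
have u_v := cyc_adj_irr uv.
have ma := inv _ _ mu; have mb := inv _ _ mv.
have ab : a != b.
  by apply: contraNneq u_v => e; move: ma; rewrite e mb => -[->].
have bu : b != u.
  by apply: contraNneq av => e; move: mb; rewrite e mu => -[->].
have degE x : #|add_edge X u v x| = #|X x| + ((x == u) || (x == v)).
  case: (eqVneq x u) => [->|xu].
    have -> : #|add_edge X u v u| = #|[predU1 v & X u]|.
      apply: eq_card => y; rewrite !inE /in_mem /= /add_edge eqxx (negPf u_v).
      by rewrite orbF orbC.
    by rewrite cardU1 [_ \in _](negPf nX) addnC.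
  case: (eqVneq x v) => [->|xv].
    have -> : #|add_edge X u v v| = #|[predU1 u & X v]|.
      apply: eq_card => y; rewrite !inE /in_mem /= /add_edge eqxx eq_sym.
      by rewrite (negPf u_v) orbC.
    by rewrite cardU1 [_ \in _]symX (negPf nX) addnC.
  rewrite addn0; apply: eq_card => y.
  by rewrite /in_mem /= /add_edge (negPf xu) (negPf xv) !orbF.
have symX' : symmetric (add_edge X u v).
  move=> x y; rewrite /add_edge symX; congr (_ || _).
  by rewrite orbC; congr (_ || _); apply: andbC.
have subC : subrel (connect X) (connect (add_edge X u v)).
  by apply: connect_sub => x y xy; apply: connect1; rewrite /add_edge xy.
have cab : connect (add_edge X u v) a b.
  have au := subC _ _ (match_connect mX ma).
  have vb := subC _ _ (match_connect mX mv).
  apply: connect_trans au (connect_trans (connect1 _) vb).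
  by rewrite /add_edge !eqxx orbT.
split.
- move=> x; rewrite degE deg /join.
  case: (eqVneq x a) => [->|xa].
    rewrite ma ab (negPf av) orbF; by case: (a == u).
  case: (eqVneq x b) => [->|xb].
    rewrite mb [b == a]eq_sym ab (negPf bu) /=; by case: (b == v).
  case: (eqVneq x u) => [exu|xu] /=; first by rewrite exu mu -exu xa.
  case: (eqVneq x v) => [exv|xv] /=; last by rewrite addn0.
  by rewrite exv mv -exv xb.
- move=> x y; rewrite /join.
  case: (eqVneq x a) => [-> [<-] //|xa].
  case: (eqVneq x b) => [-> [<-]|xb]; first by rewrite (sym_connect_sym symX').
  by case: ifP => // _ /(match_connect mX) /subC.
- move=> x y; rewrite /join.
  case: (eqVneq x a) => [-> [<-]|xa].
    by rewrite eq_sym (negPf ab) eqxx.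
  case: (eqVneq x b) => [-> [<-]|xb]; first by rewrite eqxx.
  case: ifP => // /negbT /norP[xu xv] mxy; have myx := inv _ _ mxy.
  have -> : (y == a) = false.
    by apply: contraNF xu => /eqP e; move: myx; rewrite e ma => -[->].
  have -> : (y == b) = false.
    by apply: contraNF xv => /eqP e; move: myx; rewrite e mb => -[->].
  have -> : (y == u) = false.
    by apply: contraNF xa => /eqP e; move: myx; rewrite e mu => -[->].
  have -> // : (y == v) = false.
  by apply: contraNF xb => /eqP e; move: myx; rewrite e mv => -[->].
by exists a; rewrite /join eqxx.
Qed.

End Step.

Lemma matches_start : (exists x : T, true) -> matches (fun _ _ => false) Some.
Proof.
case=> x0 _; split=> [x | x y [->] | x y [->] |] //; last by exists x0.
by rewrite eqxx; apply: eq_card0.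
Qed.

(** In the full cycle every vertex has degree 2 and hence no mate, against [match_some]. *)
Lemma matches_end m : ~ matches cyc_adj m.
Proof.
move=> mX; have [x mx] := match_some mX.
by have := (matches_full (fun _ _ => id) mX x).2 (fun=> erefl); case: (m x) mx.
Qed.

End HamiltonianCycle.

(** * The sweep for Hamiltonian cycles and its exhaustiveness *)

Definition nbr (A : seq (seq nat)) : rel nat := fun i j => j \in nth [::] A i.

Arguments nbr : simpl never.

(* A state [t] records a map [m] as in [matches], with [Some j] stored as [j.+1]
   and [None] as [0]. *)
Definition merge_mates (t : seq nat) i j : seq (seq nat) :=
  if nth 0 t i is a.+1 then
    if nth 0 t j is b.+1 then
      if a == j then [::]
      else [:: set_nth 0 (set_nth 0 (set_nth 0 (set_nth 0 t i 0) j 0) b a.+1)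
                 a b.+1]
    else [::]
  else [::].

(* Choosing the edge between [i] and [j] closes a cycle; it is Hamiltonian when
   all other vertices already have degree 2. *)
Definition closes i j (t : seq nat) :=
  if nth 0 t i == j.+1 then count (predC1 0) t == 2 else false.

Fixpoint sweep_edges i S js :=
  if js is j :: js' then
    if has (closes i j) S then None
    else sweep_edges i (S ++ flatten [seq merge_mates t i j | t <- S]) js'
  else Some S.

(* Sorting only serves to make equal states adjacent. *)
Fixpoint lex_leq (t u : seq nat) :=
  match t, u with
  | x :: t', y :: u' => if x == y then lex_leq t' u' else x <= y
  | [::], _ => true
  | _, [::] => false
  end.

Fixpoint merge_equal (S : seq (seq nat)) :=
  if S is t :: S' then
    let S'' := merge_equal S' in
    if S'' is u :: _ then if t == u then S'' else t :: S'' else [:: t]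
  else [::].

Lemma mem_merge_equal S : merge_equal S =i S.
Proof.
elim: S => //= t S IHS u; rewrite inE -IHS.
case: (merge_equal S) => [|w S'] //; case: eqP => [->|]; rewrite ?inE //.
by rewrite orbA orbb.
Qed.

(** A vertex whose edges have all been decided must have degree 2, that is, entry 0. After this
    filter, states differ only at unvisited vertices with visited neighbours, so a suitable order of
    the vertices keeps the list short. *)
Fixpoint sweep A S vs :=
  if vs is i :: vs' then
    if sweep_edges i S [seq j <- nth [::] A i | i < j] is Some S' then
      sweep A (merge_equal (sort lex_leq [seq t <- S' | nth 0 t i == 0])) vs'
    else false
  else true.

(** The initial state has [i.+1] at position [i]: every vertex is isolated and its own mate. *)
Definition no_ham_cycle A :=
  (0 < size A) && sweep A [:: iota 1 (size A)] (iota 0 (size A)).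

Section Sweep.

Variables (T : finType) (e : rel T) (code : T -> nat) (A : seq (seq nat)).
Hypothesis num : numbering code (size A).
Hypothesis eA : forall x y, e x y = nbr A (code x) (code y).
Hypothesis e_sym : symmetric e.
Variable s : seq T.
Hypotheses (s_cycle : cycle e s) (s_uniq : uniq s) (s_size : 2 < size s).
Hypothesis s_all : s =i [set: T].

Let C := cyc_adj s.

Let inj := code_inj num.

Let C_sym : symmetric C := cyc_adj_sym s.

Definition encodes t (m : T -> option T) :=
  size t = size A /\
  forall x, nth 0 t (code x) = if m x is Some y then (code y).+1 else 0.

(* The edges of the cycle that the sweep has passed when it is at vertex [i] and
   has scanned the neighbours [js] of [i]. *)
Definition swept i (js : seq nat) : rel T := fun x y =>
  let a := minn (code x) (code y) in
  C x y && ((a < i) || (a == i) && (maxn (code x) (code y) \in js)).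

(** The invariant of the sweep: some state in the list has chosen precisely those edges of the
    hypothetical cycle that have been passed. *)
Definition tracked i js (S : seq (seq nat)) := exists t m,
  [/\ t \in S, encodes t m & matches (swept i js) m].

Lemma cyc_adj_sub x y : C x y -> e x y.
Proof.
have in_s z : z \in s by rewrite s_all inE.
case/orP=> /eqP <-; last rewrite e_sym; exact: next_cycle s_cycle (in_s _).
Qed.

Lemma swept_sym i js : symmetric (swept i js).
Proof. by move=> x y; rewrite /swept minnC maxnC C_sym. Qed.

Lemma swept_sub i js : subrel (swept i js) C.
Proof. by move=> x y /andP[]. Qed.

Lemma closesE i j t m u v : code u = i -> code v = j -> u != v ->
  encodes t m -> m u = Some v -> m v ->
  (forall x, x != u -> x != v -> m x = None) -> closes i j t.
Proof.
move=> <- <- uv [sz enc] mu mv others; rewrite /closes enc mu eqxx.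
rewrite -(mkseq_nth 0 t) count_map -size_filter sz; apply/eqP.
rewrite -[2]/(size [:: code u; code v]); apply/perm_size/uniq_perm.
- by rewrite filter_uniq ?iota_uniq.
- by rewrite /= inE (inj_eq inj) uv.
move=> k; rewrite mem_filter mem_iota !inE /=; apply/idP/idP.
  case/andP=> + /(code_onto num)[x ex]; rewrite -ex enc !(inj_eq inj).
  case: (eqVneq x u) => //= xu; case: (eqVneq x v) => //= xv.
  by rewrite others.
case/pred2P=> ->; rewrite (code_lt num) enc ?mu //.
by case: (m v) mv.
Qed.

(** The outermost assignments of [merge_mates], at the mates, override the inner ones, in agreement
    with the order of the tests in [join]. *)
Lemma encodes_join t m i j u v a b : code u = i -> code v = j ->
  encodes t m -> m u = Some a -> m v = Some b -> a != v ->
  exists2 t', t' \in merge_mates t i j & encodes t' (join m u v a b).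
Proof.
move=> <- <- [sz enc] mu mv av; rewrite /merge_mates !enc mu mv (inj_eq inj).
rewrite (negPf av); eexists; first exact: mem_head.
split=> [|x].
  by rewrite !size_set_nth sz; rewrite !(maxn_idPr _) ?(code_lt num).
do 4!rewrite nth_set_nth /=; rewrite !(inj_eq inj) enc /join.
by case: (x == a); case: (x == b); case: (x == u); case: (x == v).
Qed.

Lemma tracked_edge i js j S u v : code u = i -> code v = j -> i < j ->
  j \notin js -> ~~ has (closes i j) S -> tracked i js S ->
  tracked i (rcons js j) (S ++ flatten [seq merge_mates t i j | t <- S]).
Proof.
move=> eu ev ij j_js open [t [m [tS enc mX]]].
have pairE x y : (minn (code x) (code y) == i) && (maxn (code x) (code y) == j)
    = (x == u) && (y == v) || (x == v) && (y == u).
  rewrite -!(inj_eq inj) eu ev; case: (ltngtP (code x) (code y)) => xy.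
  - rewrite [X in _ || X](_ : _ = false) ?orbF //; apply/negP.
    by case/andP=> /eqP ex /eqP ey; move: xy; rewrite ex ey ltnNge (ltnW ij).
  - rewrite [X in X || _](_ : _ = false) /= 1?andbC //; apply/negP.
    by case/andP=> /eqP ex /eqP ey; move: xy; rewrite ex ey ltnNge (ltnW ij).
  by rewrite -xy; case: (code x == i); case: (code x == j).
have newE x y : swept i (rcons js j) x y =
    add_edge (swept i js) u v x y && C x y.
  rewrite /swept /add_edge mem_rcons inE -pairE.
  by case: (C x y); case: (_ < i); case: (_ == i); case: (_ == j);
    case: (_ \in js).
case uv: (C u v); last first.
  exists t, m; rewrite mem_cat tS; split=> //; apply: eq_matches mX => x y.
  rewrite newE /add_edge; case xy: (swept i js x y) => /=.
    by rewrite (swept_sub xy).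
  apply/esym/negbTE/negP => /andP[/orP[]/andP[/eqP -> /eqP ->]]; rewrite ?uv //.
  by rewrite C_sym uv.
have nX : ~~ swept i js u v.
  rewrite /swept eu ev (minn_idPl (ltnW ij)) (maxn_idPr (ltnW ij)) ltnn eqxx.
  by rewrite (negPf j_js) /= andbF.
have [[a mu] [b mv]] :=
  matches_open s_uniq s_size s_all (@swept_sym i js) (@swept_sub i js) mX uv nX.
have u_v : u != v := cyc_adj_irr s_uniq s_size s_all uv.
(* If [u] and [v] are mates, the edge completes the Hamiltonian cycle, which [closes] would have
   reported. Otherwise the joined state is among those appended. *)
case: (eqVneq a v) => [eav | av].
  rewrite eav in mu; have others := matches_close s_uniq s_size s_all
    (@swept_sym i js) (@swept_sub i js) mX uv nX mu.
  case/hasP: open; exists t => //.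
  by apply: (closesE eu ev u_v enc mu _ others); rewrite mv.
have [t' t't enc'] := encodes_join eu ev enc mu mv av.
exists t', (join m u v a b); split=> //.
  rewrite mem_cat; apply/orP; right; apply/flattenP.
  by exists (merge_mates t i j) => //; apply: map_f.
have mX' := matches_join s_uniq s_size s_all (@swept_sym i js)
  mX uv nX mu mv av.
apply: eq_matches mX' => x y.
rewrite newE; case xy: (add_edge _ _ _ _ _) => //=; apply/esym; move: xy.
case/or3P => [/swept_sub //|/andP[/eqP -> /eqP -> //]|/andP[/eqP -> /eqP ->]].
by rewrite C_sym.
Qed.

Lemma tracked_edges i js js' S S' u : code u = i -> uniq (js ++ js') ->
  {in js', forall j, i < j < size A} -> tracked i js S ->
  sweep_edges i S js' = Some S' -> tracked i (js ++ js') S'.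
Proof.
move=> eu; elim: js' js S => [|j js' IHjs] js S /=.
  by rewrite cats0 => _ _ tr [<-].
rewrite -cat_rcons => js_u lt tr; case: ifPn => // open.
have /andP[ij /(code_onto num)[v ev]] := lt j (mem_head _ _).
apply: IHjs => // [k kjs|]; first by apply: lt; rewrite inE kjs orbT.
apply: tracked_edge eu ev ij _ open tr.
by move: js_u; rewrite cat_uniq rcons_uniq => /andP[/andP[]].
Qed.

Definition valid_rows :=
  all (fun l => uniq l && all (fun k => k < size A) l) A.

(** A sweep that runs to its end would have a state for the whole cycle, which [matches_end]
    excludes; so it must have stopped at a closing edge. *)
Lemma tracked_sweep i n S : valid_rows -> i + n = size A ->
  tracked i [::] S -> ~~ sweep A S (iota i n).
Proof.
move=> /(all_nthP [::]) rowsA; elim: n i S => [|n IHn] i S ei tr /=.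
  move: tr; rewrite -[i]addn0 ei => -[t [m [_ _ mX]]].
  apply/negP => _; apply: (@matches_end T s s_uniq s_size s_all m).
  apply: eq_matches mX => x y.
  by rewrite /swept (leq_ltn_trans (geq_minl _ _) (code_lt num x)) andbT.
have im : i < size A by rewrite -ei -addSnnS leq_addr.
have [u eu] := code_onto num im.
case E: (sweep_edges _ _ _) => [S'|] //.
have /andP[up_u /allP up_lt] := rowsA i im.
have := tracked_edges eu (js := [::]) _ _ tr E.
rewrite filter_uniq // => /(_ isT); case=> [j|t [m [tS' enc mX]]].
  by rewrite mem_filter => /andP[-> /up_lt].
(* A cycle edge with smaller end [i] leads to a later neighbour of [i], so scanning these neighbours
   settles all such edges. *)
have eX : swept i [seq j <- nth [::] A i | i < j] =2 swept i.+1 [::].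
  move=> x y; rewrite /swept; case xy: (C x y) => //=.
  rewrite in_nil andbF orbF ltnS [RHS]leq_eqVlt orbC; congr (_ || _).
  case: eqP => //= emin; rewrite mem_filter.
  have := cyc_adj_sub xy; rewrite eA => xyA.
  have := cyc_adj_irr s_uniq s_size s_all xy; rewrite -(inj_eq inj).
  move: emin xyA; case: (ltngtP (code x) (code y)) => // lt <- xyA _.
    by rewrite lt; apply: xyA.
  by rewrite lt; move: xyA; rewrite -eA e_sym eA.
apply: IHn; first by rewrite addSnnS.
exists t, m; split=> //; last exact: eq_matches mX.
(* Every cycle edge at [u] has its smaller end at most [i] and has been passed; hence [u] has no
   mate and the followed state survives the filter. *)
rewrite mem_merge_equal mem_sort mem_filter tS' andbT -eu enc.2.
rewrite (matches_full s_uniq s_size s_all (@swept_sub i _) mX u).2 // => y.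
by rewrite /in_mem /= eX /swept ltnS -eu geq_minl andbT.
Qed.

End Sweep.

Lemma not_hamiltonian (T : finType) (e : rel T) code A :
  numbering code (size A) -> (forall x y, e x y = nbr A (code x) (code y)) ->
  symmetric e -> valid_rows A -> no_ham_cycle A -> ~ hamiltonian e [set: T].
Proof.
move=> num eA e_sym rowsA /andP[A_gt0 none] [s [/andP[s_c s_u] s3 sT]].
move: none; apply/negP.
apply: (tracked_sweep num eA e_sym s_c s_u s3 sT rowsA) => //.
have [x0 _] := code_onto num A_gt0.
exists (iota 1 (size A)), Some; split; first exact: mem_head.
  by split=> [|x]; rewrite ?size_iota // nth_iota ?(code_lt num).
apply: eq_matches (matches_start _) => [x y|]; last by exists x0.
by rewrite /swept ltn0 andbF /= andbF.
Qed.

(** * Hamiltonian cycles avoiding one vertex *)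

(* A bit 1 of [p], read from the low end, accepts the first candidate in [ys] and
   a bit 0 rejects it; no bit is spent on the last candidate. *)
Fixpoint choose_bits (ys : seq nat) p : nat * positive :=
  if ys is y :: ys' then
    match ys', p with
    | _ :: _, xO p' => choose_bits ys' p'
    | _ :: _, xI p' => (y, p')
    | _, _ => (y, p)
    end
  else (0, p).

(** Once [p] is used up to its leading bit, the first free neighbour is always taken. A dead end
    yields 0, which in [ham_cycle_avoiding] is the starting vertex or the avoided one, so the test
    fails. *)
Fixpoint trail A (free : seq bool) x p n : seq nat :=
  if n is n'.+1 then
    let: (y, p') := choose_bits [seq y <- nth [::] A x | nth false free y] p in
    y :: trail A (set_nth false free y false) y p' n'
  else [::].

Definition ham_cycle_avoiding A v p :=
  let N := size A in
  let start := (v == 0) : nat in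
  let s := start :: trail A (mkseq (fun k => (k != start) && (k != v)) N)
                      start p N.-2 in
  [&& v < N, size s == N.-1, 3 <= size s, cycle (nbr A) s
    & all (fun k => (k == v) || (k \in s)) (iota 0 N)].

Section Numbered.

Variables (T : finType) (e : rel T) (c : T -> nat) (A : seq (seq nat)).
Hypothesis num : numbering c (size A).
Hypothesis eA : forall u v, e u v = nbr A (c u) (c v).

Let mono : {mono c : u v / e u v >-> nbr A u v}.
Proof. by move=> u v; rewrite eA. Qed.

Lemma hamiltonian_avoiding v p :
  ham_cycle_avoiding A (c v) p -> hamiltonian e [set~ v].
Proof.
rewrite /ham_cycle_avoiding; set s := _ :: _.
case/and5P=> vN /eqP s_sz s3 s_c /allP s_all.
pose r := rem (c v) (iota 0 (size A)).
have r_u : uniq r by rewrite rem_uniq ?iota_uniq.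
have rP k : (k \in r) = (k != c v) && (k < size A).
  by rewrite mem_rem_uniq ?iota_uniq // !inE mem_iota.
have r_s : {subset r <= s}.
  move=> k; rewrite rP => /andP[/negPf kv kN].
  by have := s_all k; rewrite mem_iota kv; apply.
have sz : size s <= size r by rewrite s_sz size_rem ?size_iota ?mem_iota.
(* The list [s] contains all vertices other than [v] and is no longer than their number, so nothing
   is repeated and [v] does not occur. *)
have s_u : uniq s := leq_size_uniq r_u r_s sz.
have [_ rs] := uniq_min_size r_u r_s sz.
have [|t et] := numbering_map num (s := s).
  by apply/allP => k; rewrite -rs rP => /andP[].
exists t; split; last 2 first.
- by rewrite -(size_map c) et.
- move=> x; rewrite !inE -(mem_map (code_inj num)) et -rs rP (code_lt num).
  by rewrite andbT (inj_eq (code_inj num)).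
by rewrite /ucycle -(mono_cycle mono) -(map_inj_uniq (code_inj num)) et s_c.
Qed.

Lemma sum_vertices (F : nat -> nat) :
  \sum_(i <- iota 0 (size A)) F i = \sum_v F (c v).
Proof.
rewrite -[RHS](big_map c predT F); apply: perm_big; apply: uniq_perm.
- exact: iota_uniq.
- by rewrite (map_inj_uniq (code_inj num)) index_enum_uniq.
move=> k; rewrite mem_iota; apply/idP/mapP => [/(code_onto num)[x <-]|[x _ ->]].
  by exists x; rewrite // mem_index_enum.
exact: code_lt num x.
Qed.

Lemma sum_nbrs (F : nat -> nat) v : valid_rows A ->
  \sum_(j <- nth [::] A (c v)) F j = \sum_(u | e v u) F (c u).
Proof.
move=> /(all_nthP [::])/(_ _ (code_lt num v))/andP[u_A /allP lt].
rewrite -[RHS]big_filter -[RHS](big_map c predT F).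
apply: perm_big; apply: uniq_perm => // [|k].
  by rewrite (map_inj_uniq (code_inj num)) filter_uniq ?index_enum_uniq.
apply/idP/mapP => [kA | [u]].
  have [u eu] := code_onto num (lt k kA).
  by exists u; rewrite // mem_filter mem_index_enum eA eu andbT.
by rewrite mem_filter eA => /andP[vu _] ->.
Qed.

End Numbered.

(** * Colour refinement *)

(** A numerical substitute for the multiset of neighbouring colours: a sum of squares is symmetric
    in the neighbours and can separate multisets with equal sums. The modulus keeps the unary
    numbers small. *)
Definition recolor (A : seq (seq nat)) (col : seq nat) :=
  [seq (nth 0 col i * 3 + sumn [seq nth 0 col j ^ 2 | j <- nth [::] A i]) %% 13
  | i <- iota 0 (size A)].

Definition coloring A k := iter k (recolor A) (map size A).

Lemma size_coloring B k : size (coloring B k) = size B.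
Proof. by case: k => [|k]; rewrite size_map ?size_iota. Qed.

(* These rounds, with the constants 3 and 13, are just enough to tell the 25
   graphs apart. *)
Definition fingerprint A := [seq sumn (coloring A k) | k <- iota 0 4].

Section Isomorphic.

Variables (T T' : finType) (e : rel T) (e' : rel T').
Variables (c : T -> nat) (c' : T' -> nat) (A A' : seq (seq nat)).
Hypothesis num : numbering c (size A).
Hypothesis eA : forall u v, e u v = nbr A (c u) (c v).
Hypothesis okA : valid_rows A.
Hypothesis num' : numbering c' (size A').
Hypothesis eA' : forall u v, e' u v = nbr A' (c' u) (c' v).
Hypothesis okA' : valid_rows A'.
Variable h : T -> T'.
Hypothesis h_bij : bijective h.
Hypothesis h_adj : forall u v, e' (h u) (h v) = e u v.

Lemma iso_sum_nbrs (F F' : nat -> nat) v :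
  (forall u, F (c u) = F' (c' (h u))) ->
  \sum_(j <- nth [::] A (c v)) F j = \sum_(j <- nth [::] A' (c' (h v))) F' j.
Proof.
move=> eF; rewrite (sum_nbrs num eA) // (sum_nbrs num' eA') //.
rewrite [RHS](reindex h) /=; last exact: onW_bij.
by apply: eq_big => u; rewrite ?h_adj.
Qed.

Lemma iso_coloring k v :
  nth 0 (coloring A k) (c v) = nth 0 (coloring A' k) (c' (h v)).
Proof.
elim: k v => [|k IHk] v.
  rewrite !(nth_map [::]) ?(code_lt num) ?(code_lt num') //.
  (* The initial colour is the degree, a sum of ones over the neighbours. *)
  by rewrite -!sum1_size; apply: (iso_sum_nbrs (F := fun=> 1) (F' := fun=> 1)).
rewrite !(nth_map 0) ?size_iota ?(code_lt num) ?(code_lt num') //.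
rewrite !nth_iota ?(code_lt num) ?(code_lt num') // !add0n -/(coloring A k).
rewrite -/(coloring A' k) IHk !sumnE !big_map; congr ((_ + _) %% _).
by apply: iso_sum_nbrs => u; rewrite IHk.
Qed.

Lemma iso_fingerprint : fingerprint A = fingerprint A'.
Proof.
apply: eq_map => k; rewrite !sumnE.
rewrite -{1}(mkseq_nth 0 (coloring A k)) -{1}(mkseq_nth 0 (coloring A' k)).
rewrite !big_map !size_coloring (sum_vertices num) (sum_vertices num').
rewrite [RHS](reindex h) /=; last exact: onW_bij.
by apply: eq_bigr => v _; apply: iso_coloring.
Qed.

End Isomorphic.

(** * Vertices and adjacency lists of a table *)

Definition vnum nd k := index (cyc_min nd k) (reps nd).

Definition nbrs nd :=
  let rs := reps nd in
  [seq [seq index (cyc_min nd (flip k)) rs | k <- cyc nd r] | r <- rs].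

Section Vertices.

Variables (G : plane_graph) (nd : seq nat) (code : dart G -> nat).
Hypothesis rep : represents nd code.

Let num := rep_num rep.

Definition vcode (v : vertex G) := vnum nd (code (val v)).

Let cyc_minE x y :
  (cyc_min nd (code x) == cyc_min nd (code y)) = same_vertex x y.
Proof. by rewrite (same_vertex_cyc_min rep). Qed.

Let min_reps (x : dart G) : cyc_min nd (code x) \in reps nd.
Proof. exact: cyc_min_reps num (rep_node rep) (@node_inj G) x. Qed.

Lemma vnum_eq (x y : dart G) :
  (vnum nd (code x) == vnum nd (code y)) = same_vertex x y.
Proof.
rewrite -cyc_minE /vnum; apply/eqP/eqP => [|-> //].
by move/(congr1 (nth 0 (reps nd))); rewrite !nth_index ?min_reps.
Qed.

(** Equal numbers put two roots in one orbit, and an orbit has only one root. Conversely, the vertex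
    with a given number is the root of the orbit of the dart with the corresponding least code. *)
Lemma numbering_vcode : numbering vcode (size (nbrs nd)).
Proof.
have symN := fconnect_sym (@node_inj G).
rewrite size_map; split=> [u v /eqP | v | k lt].
- rewrite vnum_eq => /(rootP symN).
  by rewrite (eqP (valP u)) (eqP (valP v)) => /val_inj.
- by rewrite index_mem min_reps.
have [x ex mx] := reps_code num (mem_nth 0 lt).
exists (Sub (froot node x) (roots_root symN x)).
have -> : k = vnum nd (code x) by rewrite /vnum mx index_uniq ?uniq_reps.
by apply/eqP; rewrite vnum_eq SubK /same_vertex symN connect_root.
Qed.

Lemma adj_nbrs u v : adj u v = nbr (nbrs nd) (vcode u) (vcode v).
Proof.
rewrite /nbr (nth_map 0); last by rewrite index_mem min_reps.
have [x ex mx] : exists2 x,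
    code x = nth 0 (reps nd) (vcode u) & vnum nd (code x) = vcode u.
  have lt' : vcode u < size (reps nd) by rewrite index_mem min_reps.
  have [x ex mx] := reps_code num (mem_nth 0 lt').
  by exists x => //; rewrite /vnum mx index_uniq ?uniq_reps.
have ux : same_vertex x (val u) by rewrite -vnum_eq mx.
have symN := fconnect_sym (@node_inj G).
rewrite -ex -(code_orbit num (rep_node rep) (@node_inj G)) -map_comp.
apply/existsP/mapP => [[y /andP[uy vy]] | [y]].
  exists y; first by rewrite -fconnect_orbit (connect_trans ux).
  by apply/eqP; rewrite /= -(rep_edge rep) vnum_eq.
rewrite -fconnect_orbit /= -(rep_edge rep) => xy /eqP; rewrite vnum_eq => vy.
by exists y; rewrite vy andbT /same_vertex (connect_trans _ xy) // symN.
Qed.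

Lemma adj_sym : symmetric (@adj G).
Proof.
have H (u v : vertex G) : adj u v -> adj v u.
  case/existsP=> x /andP[ux vx]; apply/existsP; exists (edge x).
  by rewrite edgeK vx ux.
by move=> u v; apply/idP/idP; apply: H.
Qed.

End Vertices.

(** The sweep visits 0, 1, 2 and so on; renumbering makes this the prescribed order. *)
Definition relabel A ord : seq (seq nat) :=
  [seq [seq index j ord | j <- nth [::] A i] | i <- ord].

Section Relabel.

Variables (T : finType) (e : rel T) (c : T -> nat) (A : seq (seq nat)).
Variable ord : seq nat.
Hypothesis num : numbering c (size A).
Hypothesis eA : forall u v, e u v = nbr A (c u) (c v).
Hypothesis perm : perm_eq ord (iota 0 (size A)).

Let ordP k : (k \in ord) = (k < size A).
Proof. by rewrite (perm_mem perm) mem_iota. Qed.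

Lemma numbering_relabel :
  numbering (fun x => index (c x) ord) (size (relabel A ord)).
Proof.
rewrite size_map; split=> [x y | x | k lt].
- move/(congr1 (nth 0 ord)); rewrite !nth_index ?ordP ?(code_lt num) //.
  by move/(code_inj num).
- by rewrite index_mem ordP (code_lt num).
have /(code_onto num)[x ex] : nth 0 ord k < size A by rewrite -ordP mem_nth.
by exists x; rewrite ex index_uniq // (perm_uniq perm) iota_uniq.
Qed.

Lemma nbr_relabel u v :
  e u v = nbr (relabel A ord) (index (c u) ord) (index (c v) ord).
Proof.
have uo : c u \in ord by rewrite ordP (code_lt num).
have vo : c v \in ord by rewrite ordP (code_lt num).
rewrite eA {2}/nbr (nth_map 0) ?index_mem // nth_index //.
apply/idP/mapP => [uv | [k uk]]; first by exists (c v).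
move=> ei; have ko : k \in ord by rewrite -index_mem -ei index_mem.
by move/(congr1 (nth 0 ord)): ei; rewrite !nth_index // /nbr => ->.
Qed.

End Relabel.

Definition graph_table nd ord := relabel (nbrs nd) ord.

Definition hypohamiltonian_table nd ord ps :=
  let A := graph_table nd ord in
  [&& simple_table nd, perm_eq ord (iota 0 (size (nbrs nd))), valid_rows A,
      no_ham_cycle A
    & (size ps == size A) &&
      all (fun v => ham_cycle_avoiding A v (nth xH ps v)) (iota 0 (size A))].

Lemma hypohamiltonian_of_table (G : plane_graph) nd (code : dart G -> nat)
    ord ps :
  represents nd code -> hypohamiltonian_table nd ord ps ->
  hypohamiltonian G /\ exists c : vertex G -> nat,
    let A := graph_table nd ord in
    [/\ numbering c (size A), forall u v, adj u v = nbr A (c u) (c v)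
      & valid_rows A].
Proof.
move=> rep /and5P[simp perm rowsA none /andP[_ /allP cycles]].
have num := numbering_relabel (numbering_vcode rep) perm.
have eA := nbr_relabel (numbering_vcode rep) (adj_nbrs rep) perm.
split; last by eexists; split; [exact: num | exact: eA |].
split; first exact: simple_of_table rep simp.
  exact: not_hamiltonian num eA (@adj_sym G) rowsA none.
move=> v; apply: (hamiltonian_avoiding num eA); apply: cycles.
by rewrite mem_iota (code_lt num).
Qed.

Definition deflatable_table base moves ord ps :=
  [&& is_map base, D5_table base, 20 <= size (reps (face_table base)),
      inflatables (face_table base) moves
    & hypohamiltonian_table (inflations (face_table base) moves) ord ps].

Lemma deflatable_of_table base moves ord ps n :
  let A := graph_table (inflations (face_table base) moves) ord in
  deflatable_table base moves ord ps ->
  size (reps (face_table base)) + size moves = n ->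
  exists G, deflatable_hypohamiltonian n G /\ exists c : vertex G -> nat,
    [/\ numbering c (size A), forall u v, adj u v = nbr A (c u) (c v)
      & valid_rows A].
Proof.
move=> A /and5P[base_map d5 le20 infl hypo] <-.
have [G0 [c0 rep0]] := map_of_table base_map.
have M0 := M4_0 (D5_of_table rep0 base_map d5).
have [K [cK [repK MK]]] := M4_of_moves (represents_dual rep0 base_map) M0 infl.
have [hypK tabK] := hypohamiltonian_of_table repK hypo.
exists K; split=> //; split=> //.
(* As [n] is the number of faces of the base plus the number of moves, the bound is the tested one
   of at least 20 faces. *)
by exists (size moves); split; first by rewrite addnC leq_add2r.
Qed.

(** * The 25 graphs *)

Definition bases : seq (seq nat) := [::
  [::
    2; 4; 6; 8; 10; 12; 14; 16; 18; 1; 20; 22; 24; 0; 13; 26; 28; 3; 30; 21;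
    9; 32; 34; 5; 36; 15; 38; 7; 40; 31; 17; 42; 44; 11; 46; 37; 23; 48; 49;
    50; 27; 52; 54; 56; 57; 47; 33; 58; 60; 25; 62; 41; 64; 29; 53; 66; 68;
    19; 70; 72; 74; 39; 76; 78; 79; 80; 82; 43; 84; 45; 69; 86; 88; 75; 35;
    77; 61; 90; 92; 51; 94; 55; 96; 85; 67; 71; 98; 59; 100; 102; 103; 63;
    104; 65; 106; 97; 81; 99; 83; 101; 87; 108; 105; 73; 91; 107; 93; 109;
    95; 89];
  [::
    2; 4; 6; 8; 10; 12; 14; 16; 18; 1; 20; 22; 24; 0; 13; 26; 28; 3; 30; 21;
    9; 32; 34; 5; 36; 15; 38; 7; 40; 31; 17; 42; 44; 11; 46; 37; 23; 48; 49;
    41; 27; 50; 52; 19; 43; 47; 33; 54; 56; 25; 58; 29; 51; 60; 62; 64; 65;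
    66; 68; 53; 70; 72; 73; 74; 76; 35; 78; 69; 39; 80; 81; 82; 84; 45; 86;
    55; 88; 57; 90; 92; 94; 59; 96; 61; 98; 63; 100; 89; 75; 91; 77; 102;
    104; 67; 93; 71; 105; 99; 83; 101; 85; 106; 107; 79; 108; 95; 109; 87;
    103; 97]].

(* The base graph, the inflated paths as pairs [(x1, x3)] of darts, the order in
   which the sweep visits the vertices, and for each [v] (in this order) a
   Hamiltonian cycle avoiding [v], encoded as for [trail]. *)
Definition certificate : Type :=
  (nat * seq (nat * nat) * seq nat * seq positive)%type.

Definition certificates : seq certificate := [::
  (0, [:: (73, 47); (73, 34); (111, 72); (73, 34); (117, 35)], [::
    11; 7; 1; 3; 10; 0; 2; 4; 5; 6; 8; 12; 13; 17; 25; 21; 26; 27; 35; 15;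
    36; 16; 20; 39; 38; 30; 14; 24; 9; 19; 22; 37; 18; 29; 23; 34; 28; 31;
    32; 33],
    [::
    12648447; 4939295; 8036351; 7397215; 7827411; 4171583; 3912941; 4012539;
    3913207; 7776059; 1196023; 720653; 8077311; 6810287; 14811135; 8206847;
    5171887; 7929855; 8114175; 3964351; 3643071; 15172351; 1982207; 3964159;
    15140223; 4145151; 4143487; 1982463; 4103423; 15844847; 720547; 8376319;
    3735551; 8321023; 3604159; 4097535; 4186111; 8339455; 2611199; 8388607]%positive);
  (0, [:: (59, 34); (73, 34); (113, 35); (121, 73); (125, 115)], [::
    0; 1; 2; 4; 7; 3; 5; 6; 8; 11; 12; 13; 17; 9; 14; 19; 18; 28; 29; 20; 10;
    15; 16; 30; 23; 24; 31; 25; 21; 22; 33; 26; 27; 37; 36; 34; 32; 35; 38;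
    39],
    [::
    10031351; 4707359; 16207071; 4876127; 544991; 6280879; 7401879; 3597149;
    2259051; 12477775; 3177575; 4535919; 2410235; 2575615; 5015791; 4174255;
    6338143; 1313853; 5289567; 798063; 2191805; 4764895; 2375883; 4473035;
    1056971; 2381023; 4173023; 4416415; 12137375; 2188769; 4381087; 6550175;
    16731359; 4484319; 2650485; 5190383; 6551711; 16593823; 2229323; 2450335]%positive);
  (0, [:: (74, 59); (59, 34); (115, 113); (116, 114); (117, 35)], [::
    0; 1; 2; 4; 7; 3; 5; 6; 8; 11; 12; 13; 17; 9; 14; 10; 19; 18; 27; 28; 20;
    15; 16; 39; 23; 29; 24; 31; 21; 22; 33; 25; 26; 36; 30; 34; 32; 35; 37;
    38],
    [::
    8532407; 5231647; 7834847; 5547871; 1413343; 13686959; 6386071; 3793757;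
    1866859; 4666703; 1064039; 8738415; 4720891; 2133247; 1331643; 4234813;
    6271407; 15259231; 1268495; 11064927; 1574255; 3988703; 4600735; 7972063;
    4596639; 2298271; 4666271; 4181215; 8532895; 1093089; 10705311; 2224799;
    8359135; 8695007; 4426485; 5124847; 2115231; 8795359; 8434591; 16135071]%positive);
  (1, [:: (61, 44); (110, 42); (115, 60); (116, 114); (117, 43)], [::
    10; 3; 1; 7; 11; 0; 2; 4; 5; 6; 8; 12; 13; 9; 14; 20; 24; 16; 15; 23; 17;
    21; 18; 38; 39; 19; 25; 28; 22; 26; 27; 30; 29; 33; 31; 34; 32; 35; 36;
    37],
    [::
    5912903; 31582815; 3720607; 7907007; 4598715; 6865215; 2299519; 2351483;
    3196317; 2929503; 2004977; 1848831; 3971831; 2959039; 6865405; 25627470;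
    2215295; 1671799; 10738751; 2829823; 578047; 551423; 5918079; 5967231;
    1626623; 1286655; 1494399; 2847615; 1265919; 11000927; 2499071; 1257727;
    1404351; 2841471; 1499007; 1404543; 2385631; 2376671; 1498495; 2492287]%positive);
  (0, [:: (73, 47); (73, 34); (111, 72); (112, 110); (111, 72)], [::
    26; 20; 25; 34; 35; 24; 16; 12; 13; 21; 30; 36; 29; 33; 31; 32; 17; 27;
    22; 28; 8; 9; 18; 23; 2; 4; 0; 7; 1; 5; 6; 3; 11; 10; 14; 39; 15; 19; 37;
    38],
    [::
    6400639; 3830527; 4997183; 7593951; 5307455; 7465951; 3439679; 1866231;
    10178471; 876479; 4563967; 7012601; 2822207; 1993727; 3541769; 3133631;
    4576255; 4454461; 2128959; 5066719; 1157759; 1810621; 2614207; 2286591;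
    1523943; 911103; 5007999; 3780522; 3731967; 1836959; 2466719; 466607;
    2315391; 1527359; 7557034; 15130538; 910847; 5460991; 15130538; 3526143]%positive);
  (0, [:: (59, 34); (74, 59); (117, 111); (121, 112); (123, 118)], [::
    20; 24; 25; 35; 36; 29; 34; 37; 31; 32; 33; 21; 13; 17; 26; 8; 27; 9; 18;
    28; 14; 5; 6; 0; 2; 12; 4; 1; 3; 7; 11; 16; 19; 23; 10; 39; 30; 15; 22;
    38],
    [::
    1625087; 7224575; 3470207; 2010415; 3667951; 7337455; 1981695; 2022703;
    868095; 4162543; 2092207; 8175486; 1608695; 3700223; 8358813; 3968957;
    1811439; 586871; 840111; 2070511; 15058814; 1975039; 1299343; 1984503;
    1862783; 1262575; 7394815; 1661115; 1286987; 1287951; 3451993; 613503;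
    1997743; 2531198; 1862767; 7453167; 867583; 1603839; 7453167; 817407]%positive);
  (0, [:: (73, 34); (110, 47); (115, 72); (73, 34); (115, 72)], [::
    36; 30; 31; 32; 33; 22; 27; 28; 17; 18; 9; 21; 8; 13; 26; 35; 20; 34; 25;
    29; 24; 12; 16; 2; 4; 0; 7; 1; 5; 6; 3; 11; 14; 10; 15; 39; 23; 19; 37;
    38],
    [::
    7831519; 864255; 1548287; 2529405; 7463039; 1310651; 3661813; 3604415;
    2605055; 2621435; 2228093; 589807; 1488895; 6750031; 6201727; 3669715;
    1702259; 395775; 1102847; 1834943; 3921855; 458735; 3657855; 2228125;
    1908735; 7704575; 851935; 916479; 851967; 1916703; 7704575; 2977535;
    3358655; 1114045; 1908735; 4325309; 409599; 1720319; 4587453; 3817471]%positive);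
  (0, [:: (59, 34); (73, 34); (113, 35); (119, 110); (120, 118)], [::
    0; 1; 2; 4; 7; 3; 5; 6; 8; 11; 12; 13; 17; 9; 14; 10; 19; 18; 25; 21; 22;
    26; 27; 28; 29; 20; 31; 36; 32; 35; 15; 37; 33; 34; 30; 24; 23; 16; 38;
    39],
    [::
    9081079; 5231135; 12016863; 4908895; 807135; 5232303; 13808023; 6808413;
    2749547; 12350799; 2649191; 9068143; 4820475; 2317567; 4540655; 4383613;
    8368559; 12672607; 9286559; 10056607; 1096161; 5468831; 12541151;
    2124861; 10575455; 1592687; 5470367; 2166667; 8747423; 8961247; 2088159;
    9810847; 4682479; 12415903; 3203733; 9526495; 1083275; 1083339; 2088159;
    1083211]%positive);
  (0, [:: (73, 34); (112, 59); (113, 35); (121, 73); (123, 118)], [::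
    0; 1; 2; 4; 7; 3; 5; 6; 8; 11; 12; 13; 17; 9; 14; 10; 19; 18; 24; 21; 22;
    25; 26; 27; 28; 31; 36; 32; 35; 30; 20; 23; 38; 16; 39; 15; 29; 33; 34;
    37],
    [::
    10440951; 10464287; 8101087; 2418527; 1609951; 14668975; 7598487;
    8315741; 2415723; 10282319; 3996775; 3230319; 1136635; 1285375; 5220591;
    1149949; 3912111; 1714783; 9388959; 6058911; 1085921; 6550175; 8363231;
    3159101; 1452639; 6551711; 4218763; 1616287; 3216607; 3988703; 800111;
    4333451; 4765919; 4256117; 12644725; 3180911; 3174773; 2585327; 8287135;
    4932511]%positive);
  (1, [:: (61, 42); (61, 44); (111, 60); (112, 110); (111, 60)], [::
    10; 3; 1; 7; 11; 0; 2; 4; 5; 6; 8; 12; 13; 14; 17; 37; 9; 38; 39; 20; 18;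
    19; 23; 24; 27; 16; 15; 22; 21; 25; 26; 29; 28; 32; 30; 33; 31; 34; 35;
    36],
    [::
    3437191; 9436767; 3982751; 4073151; 6695867; 1718335; 3348095; 2357627;
    3458461; 2932367; 3200497; 4077055; 3481143; 1718525; 3199487; 5541791;
    2770831; 1286655; 5541791; 928255; 893439; 12814158; 3263871; 3009919;
    5763967; 422007; 10739519; 5746175; 872703; 11001695; 1712639; 864511;
    2817471; 5757823; 3014527; 2817663; 1599199; 1590239; 3014015; 1705855]%positive);
  (0, [:: (74, 59); (59, 34); (115, 113); (112, 110); (115, 113)], [::
    0; 1; 2; 4; 7; 3; 5; 6; 8; 11; 12; 13; 16; 9; 14; 10; 18; 15; 17; 22; 26;
    27; 19; 38; 39; 23; 28; 30; 20; 21; 32; 24; 25; 35; 29; 33; 31; 34; 36;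
    37],
    [::
    8602039; 10463263; 6222047; 2762591; 823519; 16280751; 6844823; 7114333;
    1866859; 4666703; 2636903; 6719087; 4725307; 2150655; 2707899; 4206221;
    8237487; 3986655; 6522463; 2220859; 2521871; 4654687; 1586543; 6302063;
    4318011; 1077659; 4594079; 4757727; 8602527; 1090017; 4987295; 5370527;
    6287583; 8992991; 3174773; 4702959; 4220575; 4394207; 4207519; 9651103]%positive);
  (1, [:: (61, 44); (110, 42); (115, 60); (61, 44); (115, 60)], [::
    10; 3; 1; 7; 11; 0; 2; 4; 5; 6; 8; 12; 13; 9; 17; 19; 23; 37; 14; 38; 39;
    20; 18; 24; 27; 16; 15; 22; 21; 25; 26; 29; 28; 32; 30; 33; 31; 34; 35;
    36],
    [::
    6961479; 4718175; 3720607; 3942079; 4598715; 3437119; 2299519; 1177979;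
    3196317; 5864751; 3724785; 1979903; 6962743; 5541775; 1626623; 25663310;
    2215295; 6873593; 1718781; 1102335; 6874105; 141823; 631295; 1502591;
    2880383; 844919; 5369663; 2862591; 610559; 5500767; 1188351; 602367;
    1408447; 2874239; 1507199; 1408639; 1074911; 1065951; 1506687; 1181567]%positive);
  (0, [:: (59, 34); (74, 59); (117, 111); (110, 47); (123, 58)], [::
    0; 1; 2; 4; 7; 3; 5; 6; 8; 11; 12; 13; 16; 9; 17; 18; 26; 27; 10; 14; 19;
    38; 15; 39; 22; 23; 28; 30; 20; 21; 32; 24; 25; 35; 29; 33; 31; 34; 36;
    37],
    [::
    8530359; 8377119; 7834335; 6592351; 1331423; 5794991; 8298375; 3269469;
    3767403; 9202863; 1324087; 8738159; 2360443; 2132735; 15258975; 6271407;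
    1050223; 11064671; 2117405; 1200571; 7972063; 1122747; 3986143; 3985631;
    2171323; 4664223; 4597151; 4180703; 8530847; 4359137; 10704287; 9152863;
    8358623; 8694495; 2126063; 8030047; 4232863; 8790751; 8432543; 16133023]%positive);
  (0, [:: (73, 34); (112, 59); (113, 35); (74, 34); (115, 35)], [::
    0; 1; 2; 4; 7; 3; 5; 6; 8; 11; 12; 13; 17; 9; 14; 10; 19; 18; 27; 28; 20;
    15; 39; 23; 38; 16; 30; 24; 21; 22; 32; 25; 26; 35; 29; 33; 31; 34; 36;
    37],
    [::
    4935927; 10467871; 7806175; 6629215; 823519; 9497775; 13037975; 3924829;
    2727019; 9336143; 7453799; 4529775; 2272763; 1252607; 2468079; 2299773;
    6271407; 8273503; 2505487; 8076895; 1586543; 7972063; 9196447; 4589983;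
    3988703; 9184159; 7978207; 4694943; 5796767; 4362529; 8190367; 8778399;
    8330463; 4472031; 2155253; 2519791; 8405663; 8785119; 8401823; 8102815]%positive);
  (1, [:: (61, 42); (61, 44); (111, 60); (119, 53); (123, 115)], [::
    10; 3; 1; 7; 11; 0; 2; 4; 5; 6; 8; 12; 13; 9; 14; 20; 17; 39; 38; 19; 37;
    18; 23; 24; 27; 16; 15; 22; 21; 25; 26; 29; 28; 32; 30; 33; 31; 34; 35;
    36],
    [::
    9992907; 31583839; 3706207; 7874239; 9841595; 2355310; 2241919; 2333051;
    3181917; 5864495; 3200497; 3028479; 3709687; 2893503; 3439229; 1102335;
    1155583; 5918079; 5901695; 12815694; 545279; 1262079; 4836735; 2944383;
    5501823; 2327462; 10733375; 5484031; 1220863; 10995551; 2376191; 1204479;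
    2784703; 5495679; 2948991; 2784895; 2123487; 2114527; 2948479; 2361215]%positive);
  (0, [:: (74, 47); (112, 73); (113, 46); (47, 34); (123, 115)], [::
    20; 25; 26; 34; 35; 36; 30; 33; 31; 32; 21; 13; 17; 27; 8; 22; 28; 9; 18;
    29; 23; 37; 38; 14; 39; 19; 15; 24; 12; 16; 10; 6; 3; 5; 0; 2; 1; 4; 7;
    11],
    [::
    5098495; 7275263; 6398847; 5792647; 1820655; 2896327; 800511; 1967359;
    4080623; 1957039; 6602622; 1511159; 3765759; 1147687; 6963581; 3971055;
    1721327; 1497463; 1942447; 3642863; 801023; 1599743; 3647983; 1483879;
    839935; 3645935; 3199231; 7421822; 3707887; 2997375; 1822319; 3893135;
    3482059; 1819583; 1673207; 1822335; 2305723; 7525887; 3591951; 6395737]%positive);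
  (0, [:: (73, 47); (73, 34); (111, 72); (119, 59); (123, 115)], [::
    0; 1; 2; 4; 7; 3; 5; 6; 8; 11; 12; 13; 16; 9; 17; 18; 27; 28; 10; 14; 23;
    19; 39; 38; 15; 37; 22; 24; 20; 21; 31; 25; 26; 34; 29; 32; 30; 33; 35;
    36],
    [::
    9019639; 6746911; 11995871; 4740959; 1200351; 10474671; 6402455; 7594845;
    4826219; 10546351; 2110519; 8727919; 2409595; 2296575; 12627295; 6271407;
    2164335; 10530143; 2191645; 2255087; 9519327; 4759775; 4477167; 4509935;
    4164319; 4759775; 2114443; 9227167; 9972639; 2163681; 8566175; 9283935;
    12520159; 8674015; 2126063; 8718175; 4290719; 4259423; 8487887; 9751455]%positive);
  (1, [:: (68, 57); (68, 48); (111, 69); (119, 67); (123, 115)], [::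
    19; 24; 28; 32; 33; 29; 30; 36; 31; 35; 23; 34; 27; 25; 20; 26; 39; 37;
    21; 38; 22; 16; 18; 12; 13; 17; 15; 11; 10; 14; 3; 7; 1; 4; 2; 8; 0; 6;
    5; 9],
    [::
    16513447; 2562559; 605695; 3933162; 4091871; 2604958; 895487; 727551;
    8187359; 790015; 1776127; 646655; 6147545; 5181402; 888319; 1521631;
    904703; 1521631; 931807; 1805823; 3602911; 1718239; 2154271; 6811295;
    3546605; 1799145; 10318637; 5059418; 6667031; 3291127; 899583; 6790603;
    892397; 1339134; 1689303; 899547; 1645567; 1251582; 888605; 3542173]%positive);
  (1, [:: (61, 44); (110, 42); (115, 60); (121, 73); (120, 111)], [::
    32; 33; 34; 36; 37; 29; 21; 30; 31; 22; 27; 35; 28; 23; 16; 15; 10; 11;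
    24; 26; 18; 25; 38; 39; 14; 17; 20; 19; 3; 6; 9; 13; 5; 1; 0; 8; 2; 7; 4;
    12],
    [::
    33356565; 1768447; 1793991; 4054983; 3431871; 3825087; 931719; 3956159;
    1957831; 2030591; 1965055; 14406285; 2056135; 7442429; 4182661; 8083797;
    3580743; 3924367; 1369839; 8366421; 7321291; 8267771; 3772247; 3772255;
    1955559; 8343541; 1822695; 7305771; 3649983; 866119; 930287; 1866751;
    3719119; 3658943; 7304747; 3656703; 1863567; 3709407; 1831879; 1859567]%positive);
  (0, [:: (73, 34); (110, 47); (115, 72); (119, 59); (120, 118)], [::
    0; 1; 2; 4; 7; 3; 5; 6; 8; 11; 12; 13; 16; 9; 17; 18; 27; 28; 10; 14; 19;
    37; 23; 15; 24; 39; 38; 22; 20; 21; 31; 25; 26; 34; 29; 32; 30; 33; 35;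
    36],
    [::
    8702391; 6738719; 10195679; 4790111; 1200351; 6280367; 6717031; 7332701;
    4830315; 10179759; 1061943; 4363631; 1181115; 2175743; 6313311; 3125679;
    4338799; 5264735; 1058589; 1135035; 15942879; 2171323; 7971039; 3986143;
    9317279; 2105787; 8325855; 4263691; 8702879; 4326369; 4281759; 9283935;
    10457823; 4336351; 2150639; 7997279; 9009311; 2162271; 4293583; 16001951]%positive);
  (0, [:: (73, 47); (74, 47); (113, 46); (47, 34); (113, 46)], [::
    0; 1; 2; 4; 7; 3; 5; 6; 8; 11; 12; 13; 16; 9; 17; 18; 27; 28; 10; 14; 38;
    39; 15; 23; 19; 30; 24; 22; 20; 21; 32; 25; 26; 35; 29; 33; 31; 34; 36;
    37],
    [::
    10103223; 3404575; 15633119; 3315551; 1380575; 5797551; 3374695; 6683229;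
    2739307; 9205423; 660535; 12932463; 2410107; 2525951; 6870367; 8368559;
    1050223; 5821791; 2191773; 1216955; 7972063; 4656955; 7975647; 3985631;
    4656955; 8342239; 2328475; 9196959; 11676575; 4397345; 6509983; 9164127;
    16681695; 12888799; 1061103; 4014943; 8475295; 8661727; 8956831; 4285359]%positive);
  (0, [:: (59, 34); (73, 34); (113, 35); (74, 34); (125, 113)], [::
    0; 1; 2; 4; 7; 3; 5; 6; 8; 11; 12; 13; 17; 9; 14; 10; 19; 15; 16; 25; 18;
    21; 22; 26; 27; 28; 29; 20; 31; 36; 37; 32; 33; 23; 39; 24; 30; 34; 35;
    38],
    [::
    4411639; 10462239; 12302559; 2828127; 708831; 8378031; 6418839; 7179869;
    1211499; 10384719; 2161767; 6465135; 4835259; 2341119; 2205935; 4387309;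
    4174255; 4175071; 4416315; 2224539; 3434079; 10281887; 1095137; 4715167;
    12564703; 2554639; 2909791; 1584495; 1576303; 6442207; 4469663; 8440479;
    3250591; 4594079; 4285243; 9513183; 6407541; 4711151; 4328671; 9618335]%positive);
  (0, [:: (74, 59); (59, 34); (115, 113); (119, 47); (120, 118)], [::
    20; 24; 25; 35; 36; 29; 34; 37; 31; 32; 33; 21; 13; 17; 26; 8; 27; 9; 18;
    28; 38; 30; 39; 14; 19; 22; 15; 23; 12; 16; 10; 6; 3; 5; 0; 2; 1; 4; 7;
    11],
    [::
    6671359; 7210239; 3208063; 1923631; 3614703; 7284207; 1967359; 1948207;
    802559; 4080623; 2088111; 4767614; 1084407; 2717183; 1164071; 3313597;
    1729519; 1169783; 1950639; 1906671; 1603839; 802047; 7449071; 14793722;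
    424191; 7447023; 1603839; 7528318; 3761135; 2473087; 1848943; 2582415;
    2542411; 1843967; 1656823; 1848959; 2502331; 5428735; 2543375; 6494041]%positive);
  (1, [:: (61, 44); (112, 53); (113, 45); (112, 42); (123, 45)], [::
    10; 3; 1; 7; 11; 0; 2; 4; 5; 6; 8; 12; 13; 9; 14; 17; 39; 21; 19; 20; 38;
    18; 24; 25; 28; 16; 15; 23; 22; 26; 27; 30; 29; 33; 31; 34; 32; 35; 36;
    37],
    [::
    4485447; 6420703; 3771743; 7866047; 6569915; 3438655; 2504063; 1166715;
    3247453; 2911567; 6346225; 2897407; 6888759; 5523279; 3438845; 3621375;
    11083423; 762367; 11083167; 6416206; 1331711; 737791; 2346367; 2936191;
    5469055; 847991; 5366719; 5451263; 1089791; 10995551; 2114047; 1073407;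
    2780607; 5462911; 2940799; 2780799; 4299359; 4263519; 2940287; 2099071]%positive);
  (1, [:: (73, 53); (73, 42); (111, 72); (121, 44); (123, 118)], [::
    10; 3; 1; 7; 11; 0; 2; 4; 5; 6; 8; 12; 13; 9; 14; 20; 17; 38; 39; 18; 19;
    25; 23; 24; 28; 16; 15; 22; 26; 21; 27; 30; 29; 33; 31; 34; 32; 35; 36;
    37],
    [::
    6044363; 9431391; 3769695; 6042095; 9710523; 2357358; 2495871; 2336123;
    3245405; 5274159; 3167729; 3282431; 3458999; 2765295; 9100206; 1593855;
    1090047; 5596127; 5583327; 2138623; 12832078; 274943; 2329983; 5918079;
    4665239; 2343846; 10736831; 2099199; 5499103; 2278207; 5540735; 2367199;
    5481023; 5544831; 6195583; 5922711; 4247263; 2114527; 2257535; 2277759]%positive)].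

Definition cert_table (c : certificate) :=
  let: (i, moves, ord, _) := c in
  graph_table (inflations (face_table (nth [::] bases i)) moves) ord.

Definition valid_cert (c : certificate) :=
  let: (i, moves, ord, ps) := c in
  let base := nth [::] bases i in
  (size (reps (face_table base)) + size moves == 40)
  && deflatable_table base moves ord ps.

Definition cert0 : certificate := (0, [::], [::], [::]).

Lemma certificates_valid : all valid_cert certificates.
Proof. by vm_cast_no_check (erefl true). Qed.

Lemma fingerprints_uniq :
  uniq [seq fingerprint (cert_table c) | c <- certificates].
Proof. by vm_cast_no_check (erefl true). Qed.

Lemma size_certificates : size certificates = 25.
Proof. by []. Qed.

Theorem theorem3p2 :
  exists F : 'I_25 -> plane_graph,
    (forall k, deflatable_hypohamiltonian 40 (F k)) /\
    (forall k l, k <> l -> ~ isomorphic (F k) (F l)).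
Proof.
pose A (k : 'I_25) := cert_table (nth cert0 certificates k).
have ex k : exists G, deflatable_hypohamiltonian 40 G /\
    exists c : vertex G -> nat,
      [/\ numbering c (size (A k)), forall u v, adj u v = nbr (A k) (c u) (c v)
        & valid_rows (A k)].
  have := all_nthP cert0 certificates_valid k; rewrite size_certificates.
  move/(_ (ltn_ord k)); rewrite /A; case: nth => [[[i moves] ord] ps].
  by case/andP=> /eqP sz ok; apply: deflatable_of_table ok sz.
(* Each graph is only known to exist; the index set being finite, all 25 can be chosen at once. *)
have [F FP] := fin_all_exists ex.
exists F; split=> [k | k l kl]; first by case: (FP k).
case=> h h_bij h_adj; apply: kl; apply/val_inj/eqP.
have [_ [ck [numk adjk okk]]] := FP k; have [_ [cl [numl adjl okl]]] := FP l.
have := iso_fingerprint numk adjk okk numl adjl okl h_bij h_adj.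
pose fp := [seq fingerprint (cert_table c) | c <- certificates].
have fpE j : j < 25 ->
    nth [::] fp j = fingerprint (cert_table (nth cert0 certificates j)).
  by move=> lt; rewrite (nth_map cert0) // size_certificates.
rewrite /A -!fpE // => /eqP.
by rewrite nth_uniq ?fingerprints_uniq // size_map size_certificates.
Qed.
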